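(* Let $(\hat U^0_t)_{t\in[0,T]}$, $(\hat U^1_t)_{t\in[0,T]}$, $(\hat V_t)_{t\in[0,T]}$ be $\mathbb F^2$-progressively measurable processes, let $\hat\xi^0,\hat\xi^1,\hat\zeta\in\mathcal A^\circ_0(\mathbb F^2)$, and let $$\hat p_t=\frac{\pi(1-\hat\xi^1_{t-})}{\pi(1-\hat\xi^1_{t-})+(1-\pi)(1-\hat\xi^0_{t-})}.$$ Set, for $i=0,1$, $$\hat M^{0;i}_t=\int_{[0,t)}g^i_s\,d\hat\zeta_s+(1-\hat\zeta_{t-})\hat U^i_t,\qquad \hat N^0_t=\int_{[0,t)}\langle\pi,f_s\,d\hat\xi_s\rangle+\langle\pi,1-\hat\xi_{t-}\rangle\hat V_t .$$ Assume that (i) the process $(\hat M^{0;i}_t)_{t\in[0,T]}$ is an $\mathbb F^2$-submartingale for $i=0,1$; (ii) the process $(\hat N^0_t)_{t\in[0,T]}$ is an $\mathbb F^2$-supermartingale; (iii) for $i=0,1$, $\mathsf P$-a.s., $$f^i_t+(h^i_t-f^i_t)\frac{\Delta\hat\zeta_t}{1-\hat\zeta_{t-}}\ge\hat U^i_t\quad\text{for all }t\in[0,T]\text{ such that }\hat\zeta_{t-}<1;$$ (iv) $\mathsf P$-a.s., $$\langle\hat p_t,g_t\rangle+\frac{\langle\pi,(h_t-g_t)\Delta\hat\xi_t\rangle}{\langle\pi,1-\hat\xi_{t-}\rangle}\le\hat V_t\quad\text{for all }t\in[0,T]\text{ such that }\langle\pi,1-\hat\xi_{t-}\rangle>0;$$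 (v) $\hat V_0=\langle\pi,\hat U_0\rangle$. Then the value of the game equals $\hat V_0$ and a saddle point is given by $((\hat\xi^0,\hat\xi^1),\hat\zeta)$, i.e., is generated by the pair $(\hat\xi,\hat\zeta)\in\mathcal A^\circ_0(\mathbb F^1)\times\mathcal A^\circ_0(\mathbb F^2)$ with $\hat\xi_t=\hat\xi^0_t\mathbf 1_{\{\mathcal J=0\}}+\hat\xi^1_t\mathbf 1_{\{\mathcal J=1\}}$.
   Context: Let $T\in(0,\infty)$ and let $(\Omega,\mathcal F,\mathsf P)=(\Omega^0\times\Omega^1,\mathcal F^0\times\mathcal F^1,\mathsf P^0\times\mathsf P^1)$ be a product probability space (completed). Let $(\mathcal H_t)_{t\in[0,T]}$ be a filtration on $(\Omega^0,\mathcal F^0)$ satisfying the usual conditions up to completion, with $\mathcal H_0=\{\Omega^0,\varnothing\}$, and let $\mathbb F^2=(\mathcal F^2_t)$ be the $\mathsf P$-completion of $(\mathcal H_t\times\{\Omega^1,\varnothing\})_{t\in[0,T]}$, right-continuous. $(\Omega^1,\mathcal F^1,\mathsf P^1)$ hosts a random variable $\mathcal J\in\{0,1\}$ with $\mathsf P(\mathcal J=1)=\pi$; thus $\mathcal J$ is independent of $\mathcal F^2_T$. Set $\mathbb F^1=(\mathcal F^1_t)$ with $\mathcal F^1_t=\mathcal F^2_t\vee\sigma(\mathcal J)$; the space also carries two mutually independent $U([0,1])$ randomisation devices, independent of $\mathcal F^1_T$. Payoffs: $f^j,g^j,h^j$, $j=0,1$, are càdlàg, $\mathbb F^2$-adapted,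 with integrable supremum over $[0,T]$ of their absolute values, and $f^j_t\ge h^j_t\ge g^j_t$ for all $t\in[0,T]$ a.s. Set $f_t=f^0_t\mathbf 1_{\{\mathcal J=0\}}+f^1_t\mathbf 1_{\{\mathcal J=1\}}$, and analogously $g_t,h_t$. Player 1 observes $\mathbb F^1$ (is informed), Player 2 observes $\mathbb F^2$. For a filtration $\mathbb G$, $\mathcal A^\circ_0(\mathbb G)$ is the set of $\mathbb G$-adapted càdlàg non-decreasing $\rho$ with $\rho_{0-}:=0$, $\rho_T=1$; $\Delta\rho_t=\rho_t-\rho_{t-}$. The $\mathbb G$-randomised stopping time generated by $\rho$ is $\eta=\inf\{t\in[0,T]:\rho_t>Z\}$, $Z$ the player's randomisation device; the class of these is $\mathcal T^R_0(\mathbb G)$. With $\mathcal P(\tau,\sigma)=f_\tau\mathbf 1_{\{\tau<\sigma\}}+h_\tau\mathbf 1_{\{\tau=\sigma\}}+g_\sigma\mathbf 1_{\{\sigma<\tau\}}$, Player 1 minimises over $\tau\in\mathcal T^R_0(\mathbb F^1)$ and Player 2 maximises over $\sigma\in\mathcal T^R_0(\mathbb F^2)$ the quantity $\mathsf E[\mathcal P(\tau,\sigma)]$. The game has value $v$ if $\inf_\tau\sup_\sigma\mathsf E[\mathcal P(\tau,\sigma)]=\sup_\sigma\inf_\tau\mathsf E[\mathcal P(\tau,\sigma)]=v$; $(\hat\tau,\hat\sigma)$ is a saddle point if $\mathsf E[\mathcal P(\hat\tau,\sigma)]\le\mathsf E[\mathcal P(\hat\tau,\hat\sigma)]\le\mathsf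 E[\mathcal P(\tau,\hat\sigma)]$ for all admissible $\tau,\sigma$. Notation: $\langle q,\phi\rangle=q\phi^1+(1-q)\phi^0$ for $q\in[0,1]$ and $\phi=(\phi^0,\phi^1)$, applied componentwise, e.g. $\langle\pi,f_s\,d\hat\xi_s\rangle=\pi f^1_s\,d\hat\xi^1_s+(1-\pi)f^0_s\,d\hat\xi^0_s$, $\langle\pi,(h_t-g_t)\Delta\hat\xi_t\rangle=\pi(h^1_t-g^1_t)\Delta\hat\xi^1_t+(1-\pi)(h^0_t-g^0_t)\Delta\hat\xi^0_t$, $\langle\hat p_t,g_t\rangle=\hat p_tg^1_t+(1-\hat p_t)g^0_t$. *)

(* Defs.v *)
From HB Require Import structures.
From mathcomp Require Import all_boot all_order all_algebra.
From mathcomp Require Import all_classical all_reals all_analysis.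
From mathcomp Require Import measurable_realfun.

Set Implicit Arguments.
Unset Strict Implicit.
Unset Printing Implicit Defensive.
Import Order.TTheory GRing.Theory Num.Def Num.Theory.
Import numFieldNormedType.Exports.

Local Open Scope classical_set_scope.
Local Open Scope ring_scope.

Definition completion_type d (T : measurableType d) (R : realType)
  (P : set T -> \bar R) : Type := T.

Definition completion_display d (T : measurableType d) (R : realType) :
  (set T -> \bar R) -> measure_display.
Proof. exact. Qed.

Section completion.
Context d (T : measurableType d) (R : realType) (P : probability T R).

Let cset0 : completed_algebra_gen P set0.
Proof.
exists set0; first exact: measurable0.
by exists set0; [exact: negligible_set0|rewrite setU0].
Qed.

Let csetC (A : set T) :
  completed_algebra_gen P A -> completed_algebra_gen P (~` A).
Proof.
move=> [B mB [N [M [mM M0 NM]] <-]].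
exists (~` B `&` ~` M); first by apply: measurableI; exact: measurableC.
exists (M `&` ~` B `&` ~` N).
  by exists M; split => // x [[]].
apply/seteqP; split => [x [[nB nM] [//|/NM //]|[[_ nB] nN] [//|//]]|].
by move=> x /not_orP[nB nN]; have [|] := pselect (M x); [right|left].
Qed.

Let cbigcup (F : (set T)^nat) : (forall i, completed_algebra_gen P (F i)) ->
  completed_algebra_gen P (\bigcup_i F i).
Proof.
move=> cF.
have /choice[B BF] i : exists B, measurable B /\
    exists2 N, P.-negligible N & B `|` N = F i.
  by have [B mB ?] := cF i; exists B.
have /choice[N BN] i : exists N, P.-negligible N /\ B i `|` N = F i.
  by have [_ [N nN e]] := BF i; exists N.
exists (\bigcup_i B i); first by apply: bigcupT_measurable => i; have [] := BF i.
exists (\bigcup_i N i); first by apply: negligible_bigcup => i; have [] := BN i.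
by rewrite -bigcupU; apply: eq_bigcupr => i _; have [] := BN i.
Qed.

HB.instance Definition _ := Pointed.on (completion_type P).
HB.instance Definition _ := @isMeasurable.Build (completion_display P)
  (completion_type P) (completed_algebra_gen P) cset0 csetC cbigcup.

(* the outer measure of P takes on [A `|` N] the value [P A] *)
Definition completion : set (completion_type P) -> \bar R := mu_ext P.

Lemma completionE (A : set T) : measurable A -> completion A = P A.
Proof. exact: measurable_mu_extE. Qed.

Lemma completed_algebra_caratheodory (A : set T) :
  completed_algebra_gen P A -> caratheodory_measurable (mu_ext P) A.
Proof.
move=> [B mB [N [M [mM M0 NM]] <-]].
apply: (caratheodory_measurable_setU (mu := (mu_ext P : {outer_measure set T -> \bar R}))).
  exact: caratheodory_measurable_mu_ext.
apply: (measure_is_complete_caratheodory (mu := (mu_ext P : {outer_measure set T -> \bar R}))).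
exists M; split => //; first exact: caratheodory_measurable_mu_ext.
exact: etrans (measurable_mu_extE _ mM) M0.
Qed.

Let completion0 : completion set0 = 0%E.
Proof. by rewrite completionE ?measure0. Qed.

Let completion_ge0 A : (0 <= completion A)%E.
Proof. exact: mu_ext_ge0. Qed.

Let completion_additive : semi_sigma_additive completion.
Proof.
move=> F mF tF mUF; apply: caratheodory_measure_sigma_additive => //.
- by move=> i; exact/completed_algebra_caratheodory/mF.
- exact: completed_algebra_caratheodory.
Qed.

HB.instance Definition _ := isMeasure.Build _ _ _ completion
  completion0 completion_ge0 completion_additive.

Let completionT : completion setT = 1%E.
Proof. by rewrite completionE ?probability_setT. Qed.

HB.instance Definition _ := Measure_isProbability.Build _ _ _ completion
  completionT.

End completion.
Arguments completion {d T R} P _.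

Definition mk_cumulative (R : realType) (F : R -> R)
  (_ : nondecreasing F) (_ : right_continuous F) : R -> R := F.

HB.instance Definition _ (R : realType) (F : R -> R)
    (Fnd : nondecreasing F) (Frc : right_continuous F) :=
  isCumulative.Build R _ R (mk_cumulative Fnd Frc) Fnd Frc.

Section path.
Context (R : realType) (T : R).
Implicit Types a : R -> R.

Definition cadlag a :=
  (forall t, 0 <= t < T -> a s @[s --> t^'+] --> a t) /\
  (forall t, 0 < t <= T -> cvg (a s @[s --> t^'-])).

(* the value [a_{t-}], with the convention [a_{0-} = 0] *)
Definition left_lim a (t : R) : R :=
  if t <= 0 then 0 else lim (a s @[s --> t^'-]).

Definition jump a (t : R) : R := a t - left_lim a t.

(* [a_{0-} = 0] makes [0 <= a 0] part of the monotonicity *)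
Definition generating_path a :=
  [/\ cadlag a, 0 <= a 0,
      (forall s t, 0 <= s -> s <= t -> t <= T -> a s <= a t) & a T = 1].

(* extension of a path from [[0, T]] to the real line, so that the jump of size
   [a 0] at time [0] is charged by the associated measure *)
Definition extend_path a (t : R) : R := if t < 0 then 0 else a (Num.min t T).

(* The measure [da]. The value [mzero] is only there to make the definition
   total: it is never used when [a] is a generating path, see [stieltjesE]. *)
Definition stieltjes a : {measure set (measurableTypeR R) -> \bar R} :=
  match pselect (nondecreasing (extend_path a)),
        pselect (right_continuous (extend_path a)) with
  | left nd, left rc => lebesgue_stieltjes_measure (mk_cumulative nd rc)
  | _, _ => mzero
  end.

Lemma extend_path_nondecreasing a : 0 <= T -> generating_path a ->
  nondecreasing (extend_path a).
Proof.
move=> T0 [_ a0 nda _] s t st; rewrite /extend_path.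
have [s0|s0] := ltP s 0; have [t0|t0] := ltP t 0 => //.
- by rewrite (le_trans a0)// nda// ?le_min ?t0 ?ge_min ?lexx ?orbT.
- by move: (le_lt_trans st t0); rewrite ltNge s0.
- apply: nda; first by rewrite le_min s0.
  + by rewrite le_min !ge_min st lexx orbT.
  + by rewrite ge_min lexx orbT.
Qed.

Lemma extend_path_right_continuous a : generating_path a ->
  right_continuous (extend_path a).
Proof.
move=> [[rca _] _ _ _] t.
have [t0|t0] := ltP t 0.
  rewrite /extend_path t0; apply: cvg_near_cst.
  by near=> s; rewrite ifT//; near: s; exact: nbhs_right_lt.
rewrite {2}/extend_path ltNge t0/=.
have [Tt|tT] := leP T t.
  rewrite ?(min_idPr Tt).
  apply: cvg_near_cst; near=> s.
  have ts : t < s by near: s; exact: nbhs_right_gt.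
  rewrite /extend_path ltNge (le_trans t0 (ltW ts))/=.
  by rewrite (min_idPr (le_trans Tt (ltW ts))).
rewrite ?(min_idPl (ltW tT)).
have at_ : a s @[s --> t^'+] --> a t by apply: rca; rewrite t0.
apply: cvg_trans at_; apply: near_eq_cvg; near=> s.
have ts : t < s by near: s; exact: nbhs_right_gt.
have sT : s < T by near: s; exact: nbhs_right_lt.
by rewrite /extend_path ltNge (le_trans t0 (ltW ts))/= (min_idPl (ltW sT)).
Unshelve. all: by end_near. Qed.

Lemma stieltjesE a : 0 <= T -> generating_path a ->
  exists nd rc,
    stieltjes a = lebesgue_stieltjes_measure
      (@mk_cumulative R (extend_path a) nd rc).
Proof.
move=> T0 ga; rewrite /stieltjes.
case: pselect => [nd|]; last by move/(_ (extend_path_nondecreasing T0 ga)).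
case: pselect => [rc|]; last by move/(_ (extend_path_right_continuous ga)).
by exists nd, rc.
Qed.

End path.

Section process.
Context d (Om : measurableType d) (R : realType) (P : probability Om R) (T : R).
Implicit Types (F : R -> set (set Om)) (G : set (set Om)) (X : R -> Om -> R).

Definition measurable_wrt G (Y : Om -> R) :=
  measurable_fun setT (Y : g_sigma_algebraType G -> R).

Definition filtration F :=
  (forall t, 0 <= t <= T -> sigma_algebra setT (F t) /\ F t `<=` measurable) /\
  (forall s t, 0 <= s -> s <= t -> t <= T -> F s `<=` F t).

Definition right_continuous_filtration F :=
  forall t, 0 <= t < T -> F t = \bigcap_(s in [set s | t < s <= T]) F s.

Definition complete_filtration F (t : R) : set (set Om) :=
  <<s F t `|` [set N | P.-negligible N] >>.

Definition adapted F X := forall t, 0 <= t <= T -> measurable_wrt (F t) (X t).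

Definition progressively_measurable F X := forall t, 0 <= t <= T ->
  measurable_fun (`[0, t] `*` setT)
    (fun z : R * g_sigma_algebraType (F t) => X z.1 z.2).

Definition conditional_expectation G (X Y : Om -> R) :=
  [/\ measurable_wrt G Y, P.-integrable setT (EFin \o Y) &
      forall A, G A -> \int[P]_(w in A) Y w = \int[P]_(w in A) X w].

Definition submartingale F X :=
  [/\ adapted F X,
      (forall t, 0 <= t <= T -> P.-integrable setT (EFin \o X t)) &
      forall s t, 0 <= s -> s <= t -> t <= T ->
        exists2 Y, conditional_expectation (F s) (X t) Y &
                   {ae P, forall w, X s w <= Y w}].

Definition supermartingale F X :=
  [/\ adapted F X,
      (forall t, 0 <= t <= T -> P.-integrable setT (EFin \o X t)) &
      forall s t, 0 <= s -> s <= t -> t <= T ->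
        exists2 Y, conditional_expectation (F s) (X t) Y &
                   {ae P, forall w, Y w <= X s w}].

Definition payoff_process F X :=
  [/\ adapted F X, forall w, cadlag T (X ^~ w) &
      P.-integrable setT
        (fun w => ereal_sup [set `|X t w|%:E | t in `[0, T]%classic])].

Definition mutually_independent3 G1 G2 G3 := forall A1 A2 A3,
  G1 A1 -> G2 A2 -> G3 A3 ->
  P (A1 `&` A2 `&` A3) = (P A1 * P A2 * P A3)%E.

Definition uniform01 (Z : {RV P >-> R}) :=
  forall B, measurable B -> distribution P Z B = uniform_prob (@ltr01 R) B.

(* the class A^o_0(F) *)
Definition generating_processes F : set (R -> Om -> R) :=
  [set rho | adapted F rho /\ forall w, generating_path T (rho ^~ w)].

(* the set is empty only when [Z w >= 1], an event of probability [0] for the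
   randomisation devices; [inf set0] is [0] *)
Definition generated_time (Z : Om -> R) (rho : R -> Om -> R) (w : Om) : R :=
  inf [set t | 0 <= t <= T /\ Z w < rho t w].

Definition randomised_stopping_times (Z : Om -> R) F : set (Om -> R) :=
  [set generated_time Z rho | rho in generating_processes F].

Definition payoff (f h g : R -> Om -> R) (tau sigma : Om -> R) (w : Om) : R :=
  f (tau w) w * (tau w < sigma w)%R%:R + h (tau w) w * (tau w == sigma w)%:R +
  g (sigma w) w * (sigma w < tau w)%R%:R.

End process.

(* [S1] and [S2] are the strategies of the minimiser and of the maximiser *)
Definition game_value (R : realType) (St : Type) (S1 S2 : set St)
    (E : St -> St -> \bar R) (v : R) :=
  ereal_inf [set ereal_sup [set E x y | y in S2] | x in S1] = v%:E /\
  ereal_sup [set ereal_inf [set E x y | x in S1] | y in S2] = v%:E.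

Definition saddle_point (R : realType) (St : Type) (S1 S2 : set St)
    (E : St -> St -> \bar R) (x0 y0 : St) :=
  [/\ S1 x0, S2 y0, (forall y, S2 y -> (E x0 y <= E x0 y0)%E) &
      forall x, S1 x -> (E x0 y0 <= E x y0)%E].

(* [<q, phi>]; a pair indexed by {0,1} is a family over [bool], [true] being
   the index 1 *)
Definition pairing (R : realType) (q : R) (phi : bool -> R) : R :=
  q * phi true + (1 - q) * phi false.

Section information.
Context d0 d1 (T0 : measurableType d0) (T1 : measurableType d1) (R : realType).
Context (P0 : probability T0 R) (P1 : probability T1 R).

Definition completed_product : measurableType _ :=
  completion_type (P0 \x P1)%E.

Definition completed_product_prob : probability completed_product R :=
  completion (P0 \x P1)%E.

Local Notation Om := completed_product.
Local Notation P := completed_product_prob.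

(* the sets of [H t] x {Omega^1, empty set} *)
Definition cylinders (H : R -> set (set T0)) (t : R) : set (set Om) :=
  [set A `*` B | A in H t & B in [set [set: T1]; set0]].

Definition uninformed_filtration (H : R -> set (set T0)) : R -> set (set Om) :=
  complete_filtration P (cylinders H).

Definition informed_filtration (H : R -> set (set T0)) (J : T1 -> bool) (t : R) :
    set (set Om) :=
  <<s uninformed_filtration H t `|`
      g_sigma_algebra_preimage (fun w : Om => J w.2) >>.

Definition mixture (J : T1 -> bool) (X : bool -> R -> Om -> R) (t : R) (w : Om) :
    R :=
  if J w.2 then X true t w else X false t w.

End information.
Arguments uninformed_filtration {d0 d1 T0 T1 R} P0 P1 H _.
Arguments informed_filtration {d0 d1 T0 T1 R} P0 P1 H J _.

Section verification.
Context (R : realType) (Om : Type) (T pi0 : R).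
Implicit Types (xi f : bool -> R -> Om -> R) (zeta g U V : R -> Om -> R).

(* <pi, 1 - xi_{t-}> *)
Definition survival xi (t : R) (w : Om) : R :=
  pairing pi0 (fun i => 1 - left_lim (xi i ^~ w) t).

Definition posterior xi (t : R) (w : Om) : R :=
  pi0 * (1 - left_lim (xi true ^~ w) t) / survival xi t w.

Definition M_process g zeta U (t : R) (w : Om) : R :=
  \int[stieltjes T (zeta ^~ w)]_(s in `[0, t[) g s w +
  (1 - left_lim (zeta ^~ w) t) * U t w.

Definition N_process f xi V (t : R) (w : Om) : R :=
  pairing pi0 (fun i => \int[stieltjes T (xi i ^~ w)]_(s in `[0, t[) f i s w) +
  survival xi t w * V t w.

End verification.

(* Main.v *)
(** It suffices to show that no stopping time of Player 1 does better than [v]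
    against [zeta], and no stopping time of Player 2 better than [v] against
    [xi]; after the exchange [(f, h, g) -> (-g, -h, -f)] both claims bound from
    below the payoff of a deviating player whose opponent is fixed.

    The processes [U] and [V] have no path regularity, so [M] and [N] cannot be
    sampled at the deviating time [tau]. Instead [tau] is replaced by the grid
    time that follows it strictly (by [T] on [tau = T]). On the grid only
    discrete optional sampling is needed, and the events [grid time <= tau]
    depend on the past alone, without right-continuity of the filtration. As
    the mesh tends to 0 the payoff converges, by right-continuity of the paths,
    to the payoff at [tau], except that a tie before [T] is resolved in favour
    of the opponent stopping first; the order of [f], [g], [h] makes this a
    bound in the right direction.

    At a grid time [t], integrating out the opponent's randomisation device
    turns the payoff into
    [int_[0,t) g d rho + f_t (1 - rho_t) + h_t (rho_t - rho_{t-})], because the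
    generalised inverse of [rho] pushes the uniform law to [d rho]; conditions
    (iii) and (iv) compare this with [M] and [N]. Submartingale increments of
    the small filtration keep their sign on events enlarged by [J] and by the
    deviator's device, as these are independent of the small filtration. *)

Require Import Defs.
From HB Require Import structures.
From mathcomp Require Import all_boot all_order all_algebra.
From mathcomp Require Import all_classical all_reals all_analysis.
From mathcomp Require Import measurable_realfun ring lra.

Set Implicit Arguments.
Unset Strict Implicit.
Unset Printing Implicit Defensive.
Import Order.TTheory GRing.Theory Num.Def Num.Theory.
Import numFieldNormedType.Exports.

Local Open Scope classical_set_scope.
Local Open Scope ring_scope.

(** * Integrals over generated sigma-algebras *)

Section weighted_integrals.
Context d (T : measurableType d) (R : realType) (P : probability T R).
Implicit Types (X Y : T -> R) (A B : set T) (G : set (set T)).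

Local Notation integ X := (P.-integrable setT (EFin \o X)).

Lemma integ_measurable X : integ X -> measurable_fun setT X.
Proof. by move=> iX; apply/measurable_EFinP; exact: measurable_int iX. Qed.

Lemma integ_indic X A : measurable A -> integ X -> integ (fun w => X w * \1_A w).
Proof.
move=> mA iX; apply: (@le_integrable _ _ _ P _ measurableT (EFin \o (fun w => X w * \1_A w))
  (EFin \o X)) => //.
  apply/measurable_EFinP; apply: measurable_funM.
    exact: integ_measurable.
  exact: measurable_indic.
move=> w _ /=; rewrite lee_fin normrM indicE.
by case: (w \in A); rewrite ?normr1 ?mulr1 ?normr0 ?mulr0.
Qed.

Lemma integ_bounded X (M : R) : measurable_fun setT X -> (forall w, `|X w| <= M) ->
  integ X.
Proof.
move=> mX XM; apply: (@le_integrable _ _ _ P _ measurableT _ (EFin \o cst M)).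
- exact/measurable_EFinP.
- by move=> w _; rewrite /= lee_fin (le_trans (XM w))// ler_norm.
- exact: finite_measure_integrable_cst.
Qed.

Lemma integD X Y : integ X -> integ Y -> integ (fun w => X w + Y w).
Proof. by move=> iX iY; exact: (integrableD measurableT iX iY). Qed.

Lemma integB X Y : integ X -> integ Y -> integ (fun w => X w - Y w).
Proof. by move=> iX iY; exact: (integrableB measurableT iX iY). Qed.

Lemma integZ c X : integ X -> integ (fun w => c * X w).
Proof. by move=> iX; exact: (integrableZl measurableT c iX). Qed.

Lemma integ_sum n (X : nat -> T -> R) : (forall k, (k < n)%N -> integ (X k)) ->
  integ (fun w => \sum_(k < n) X k w).
Proof.
elim: n X => [|n ih] X iX.
  apply: (@eq_integrable _ _ _ _ _ measurableT (cst 0%E)); last exact: integrable0.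
  by move=> w _ /=; rewrite big_ord0.
apply: (@eq_integrable _ _ _ _ _ measurableT
    (EFin \o (fun w => \sum_(k < n) X k w + X n w))).
  by move=> w _ /=; rewrite big_ord_recr.
by apply: integD; [apply: ih => k kn; apply: iX; rewrite ltnS ltnW|exact: iX].
Qed.

Lemma Rintegral_sum n (X : nat -> T -> R) : (forall k, (k < n)%N -> integ (X k)) ->
  \int[P]_w (\sum_(k < n) X k w) = \sum_(k < n) \int[P]_w X k w.
Proof.
elim: n X => [|n ih] X iX.
  under eq_Rintegral do rewrite big_ord0.
  by rewrite Rintegral_cst ?mul0r ?big_ord0.
under eq_Rintegral do rewrite big_ord_recr/=.
rewrite big_ord_recr/= RintegralD//.
- by rewrite ih// => k kn; apply: iX; rewrite ltnS ltnW.
- by apply: integ_sum => k kn; apply: iX; rewrite ltnS ltnW.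
- exact: iX.
Qed.

Lemma Rintegral_setE X A :
  \int[P]_(w in A) X w = \int[P]_w (X w * \1_A w).
Proof.
rewrite Rintegral_mkcond; apply: eq_Rintegral => w _.
by rewrite /patch indicE; case: ifPn => _; rewrite ?mulr1 ?mulr0.
Qed.

Lemma Rintegral_natr_bool (b : T -> bool) : measurable_fun setT b ->
  \int[P]_w (b w)%:R = fine (P [set w | b w]).
Proof.
move=> mb; have mB : measurable [set w | b w].
  by rewrite -[X in measurable X]setTI; exact: mb.
transitivity (\int[P]_(_ in [set w | b w]) 1); last by rewrite Rintegral_cst// mul1r.
rewrite [RHS]Rintegral_setE; apply: eq_Rintegral => w _.
rewrite mul1r indicE; case: (boolP (b w)) => bw; first by rewrite mem_set.
by rewrite memNset//=; exact/negP.
Qed.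

Lemma ae_eq_Rintegral X Y : measurable_fun setT X -> measurable_fun setT Y ->
  {ae P, forall w, X w = Y w} -> \int[P]_w X w = \int[P]_w Y w.
Proof.
move=> mX mY XY; congr fine; apply: ae_eq_integral => //.
- exact/measurable_EFinP.
- exact/measurable_EFinP.
- by apply: filterS XY => w /= -> _.
Qed.

Lemma ae_le_Rintegral X Y : integ X -> integ Y -> {ae P, forall w, X w <= Y w} ->
  \int[P]_w X w <= \int[P]_w Y w.
Proof.
move=> iX iY XY; rewrite -subr_ge0 -RintegralB//.
have mXY := integ_measurable (integB iY iX).
(* The difference is nonnegative only almost everywhere; its absolute value is so everywhere and has
   the same integral. *)
rewrite (@ae_eq_Rintegral _ (fun w => `|Y w - X w|))//.
- exact: Rintegral_ge0.
- exact: measurableT_comp.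
- by apply: filterS XY => w XYw; rewrite ger0_norm// subr_ge0.
Qed.

(** The sets over which [X] integrates to 0 form a Dynkin system, the vanishing of the total
    integral giving complements; the pi-system [G] then passes the property on to [<<s G >>]. *)
Lemma integral_zero_dynkin X G : integ X -> setI_closed G -> G `<=` measurable ->
  \int[P]_w X w = 0 -> (forall A, G A -> \int[P]_(w in A) X w = 0) ->
  forall A, <<s G >> A -> \int[P]_(w in A) X w = 0.
Proof.
move=> iX GI mG X0 XG A GA.
suff: <<s G >> `<=` [set A | measurable A /\ \int[P]_(w in A) X w = 0].
  by move=> /(_ _ GA)[].
have iXA B : measurable B -> P.-integrable B (EFin \o X).
  by move=> mB; apply: integrableS iX.
apply: lambda_system_subset => //; last first.
  by move=> B GB; split; [exact: mG|exact: XG].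
apply/dynkin_lambda_system; split => //.
- move=> B [mB XB]; split; first exact: measurableC.
  move: X0; rewrite -(setUv B) Rintegral_setU ?XB ?add0r//.
  + exact: measurableC.
  + by rewrite setUv.
  + by apply/disj_setPS; rewrite setICr.
- move=> F tF GF; have mF k : measurable (F k) by have [] := GF k.
  split; first exact: bigcupT_measurable.
  rewrite /Rintegral integral_bigcup//; last exact/iXA/bigcupT_measurable.
  rewrite eseries0// => k _ _; have [_] := GF k.
  by rewrite -[in X in _ -> X](fineK (integrable_fin_num (mF k) (iXA _ (mF k)))) /Rintegral => ->.
Qed.

(** The intersections of a set of [G1] with a set of [G2] form a pi-system, which contains both
    families because each of them contains [setT]. *)
Lemma integral_zero_join X G1 G2 : integ X ->
  G1 `<=` measurable -> G2 `<=` measurable ->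
  setI_closed G1 -> setI_closed G2 -> G1 setT -> G2 setT ->
  (forall A B, G1 A -> G2 B -> \int[P]_(w in A `&` B) X w = 0) ->
  forall A, <<s G1 `|` G2 >> A -> \int[P]_(w in A) X w = 0.
Proof.
move=> iX mG1 mG2 G1I G2I G1T G2T X0 A GA.
pose G := [set A `&` B | A in G1 & B in G2].
have XT : \int[P]_w X w = 0 by rewrite -[setT]setTI X0.
apply: (@integral_zero_dynkin X G) => //.
- move=> _ _ [A1 GA1 [B1 GB1 <-]] [A2 GA2 [B2 GB2 <-]].
  by rewrite setIACA; exists (A1 `&` A2); [exact: G1I|exists (B1 `&` B2); [exact: G2I|]].
- by move=> _ [A1 GA1 [B1 GB1 <-]]; apply: measurableI; [exact: mG1|exact: mG2].
- by move=> _ [A1 GA1 [B1 GB1 <-]]; exact: X0.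
- suff : <<s G1 `|` G2 >> `<=` <<s G >> by exact.
  apply: smallest_sub; first exact: smallest_sigma_algebra.
  move=> B [GB|GB]; apply: sub_sigma_algebra.
    by exists B => //; exists setT => //; rewrite setIT.
  by exists setT => //; exists B => //; rewrite setTI.
Qed.

End weighted_integrals.

(** * Integrating out an independent variable *)

Section independence.
Context d (T : measurableType d) (R : realType) (P : probability T R).
Context (G : set (set T)) (G_sub : <<s G >> `<=` measurable).
Local Notation integ X := (P.-integrable setT (EFin \o X)).

Lemma measurable_sub_sigma dS (S : measurableType dS) (X : T -> S) :
  measurable_fun setT (X : g_sigma_algebraType G -> S) -> measurable_fun setT X.
Proof.
by move=> mX _ B mB; apply: G_sub; exact: mX.
Qed.

(** The identity read as a map into the smaller sigma-algebra: its law [P'] is the restriction of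
    [P] to [<<s G >>], so that Fubini for [P' \x mu] yields functions measurable with respect to
    [G]. *)
Let restrict_id (w : T) : g_sigma_algebraType G := w.

Let measurable_restrict_id : measurable_fun setT restrict_id.
Proof. by move=> _ A GA; rewrite setTI; exact: G_sub. Qed.

HB.instance Definition _ := @isMeasurableFun.Build _ _ _ _ restrict_id
  measurable_restrict_id.

Local Notation P' := (distribution P restrict_id).

Section fubini.
Context dS (S : measurableType dS) (Z : T -> S) (mZ : measurable_fun setT Z).
Context (mu : probability S R).
Hypothesis Z_indep : forall A B, <<s G >> A -> measurable B ->
  P (A `&` Z @^-1` B) = (P A * mu B)%E.

Let kappa (w : T) : g_sigma_algebraType G * S := (restrict_id w, Z w).

Let measurable_kappa : measurable_fun setT kappa.
Proof. exact: measurable_fun_pair. Qed.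

HB.instance Definition _ := @isMeasurableFun.Build _ _ _ _ kappa
  measurable_kappa.

Implicit Type X : g_sigma_algebraType G * S -> R.

(** Independence is the product formula on rectangles, and these determine the product measure. *)
Let product_law A : measurable A -> (P' \x mu)%E A = distribution P kappa A.
Proof.
by move=> mA; apply: product_measure_unique => // B C mB mC; exact: Z_indep.
Qed.

Let integrable_product X : measurable_fun setT X -> integ (X \o kappa) ->
  (P' \x mu)%E.-integrable setT (EFin \o X).
Proof.
move=> /measurable_EFinP mX iX.
have [_ ioo] := integrableP _ _ _ (integrable_pushforward measurable_kappa mX iX measurableT).
apply/integrableP; split => //.
by rewrite (@eq_measure_integral _ _ _ _ (distribution P kappa)) => // A mA _; exact: product_law.
Qed.

Let integral_product X : measurable_fun setT X -> integ (X \o kappa) ->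
  (\int[P]_w (X (kappa w))%:E = \int[P' \x mu]_z (X z)%:E)%E.
Proof.
move=> /measurable_EFinP mX iX.
rewrite (@eq_measure_integral _ _ _ _ (distribution P kappa)); last first.
  by move=> A mA _; exact: product_law.
by rewrite (integral_pushforward measurable_kappa mX).
Qed.

Let partial_integral X w := \int[mu]_z X (w, z).

Lemma measurable_partial_integral X : measurable_fun setT X -> integ (X \o kappa) ->
  measurable_fun setT (fun w : g_sigma_algebraType G => \int[mu]_z X (w, z)).
Proof.
move=> mX iX; apply: measurableT_comp => //.
exact: measurable_fubini_F (integrable_product mX iX).
Qed.

Let integrable_partial_integral' X : measurable_fun setT X -> integ (X \o kappa) ->
  P'.-integrable setT (EFin \o partial_integral X).
Proof.
move=> mX iX; have iF := integrable_fubini_F (integrable_product mX iX).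
apply: le_integrable iF => //.
  by apply/measurable_EFinP; exact: measurable_partial_integral.
move=> w _; rewrite /= /partial_integral /Rintegral /fubini_F/=.
(* An infinite inner integral is sent to 0 by [fine], so the bound by the extended-valued integral
   survives. *)
by case: (\int[mu]_y (X (w, y))%:E)%E => [r| |]; rewrite //= normr0 leey.
Qed.

Let integral_partial_integral' X : measurable_fun setT X -> integ (X \o kappa) ->
  (\int[P]_w (X (w, Z w))%:E = \int[P']_w (partial_integral X w)%:E)%E.
Proof.
move=> mX iX; have iF := integrable_fubini_F (integrable_product mX iX).
rewrite [LHS]integral_product// -integral12_prod_meas1//; last exact: integrable_product.
apply: ae_eq_integral => //.
- exact: measurable_int iF.
- exact: measurable_int (integrable_partial_integral' mX iX).
(* Almost every inner integral is finite, and there [fine] loses nothing. *)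
- have := integrable_ae measurableT iF; apply: filterS => w /(_ I) finF _.
  by rewrite [LHS]/= -[LHS]fineK.
Qed.

Lemma integrable_partial_integral X : measurable_fun setT X -> integ (X \o kappa) ->
  integ (fun w => \int[mu]_z X (w, z)).
Proof.
move=> mX iX; apply/integrableP; split.
  by apply/measurable_EFinP/measurable_sub_sigma; exact: measurable_partial_integral.
have [mF] := integrableP _ _ _ (integrable_partial_integral' mX iX).
rewrite ge0_integral_pushforward//.
exact/measurableT_comp.
Qed.

(** Freezing: the [G]-measurable argument is held fixed while the independent [Z] is integrated
    against its law. The set [A] enters as an indicator of the first coordinate, which reduces the
    claim to the whole space. *)
Lemma Rintegral_partial_integral X A : <<s G >> A ->
  measurable_fun setT X -> integ (fun w => X (w, Z w)) ->
  \int[P]_(w in A) X (w, Z w) = \int[P]_(w in A) (\int[mu]_z X (w, z)).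
Proof.
move=> GA mX iX; rewrite [LHS]Rintegral_setE [RHS]Rintegral_setE.
pose Y z := X z * \1_A z.1.
have mY : measurable_fun setT Y.
  apply: measurable_funM => //.
  have m1A : measurable_fun setT (\1_A : g_sigma_algebraType G -> R).
    by apply: measurable_indic.
  refine (measurableT_comp m1A _); exact: measurable_fst.
have iY : integ (Y \o kappa) by apply: integ_indic => //; exact: G_sub.
transitivity (fine (\int[P']_w (partial_integral Y w)%:E)%E).
  by have := integral_partial_integral' mY iY; rewrite /Rintegral => <-.
have iY' := integrable_partial_integral mY iY.
rewrite (integral_pushforward measurable_restrict_id)//; last first.
  by apply/measurable_EFinP; exact: measurable_partial_integral.
apply: eq_Rintegral => w _.
rewrite /partial_integral /Y/= indicE; case: (w \in A).
  by rewrite mulr1; apply: eq_Rintegral => z _; rewrite mulr1.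
rewrite mulr0; under eq_Rintegral do rewrite mulr0.
by rewrite Rintegral_cst// mul0r.
Qed.

End fubini.

(** The freezing lemma with [Z] the indicator of [B], whose mean is the probability of [B]. *)
Lemma Rintegral_indep_event X A B : <<s G >> A -> measurable B ->
  (forall C, <<s G >> C -> P (C `&` B) = (P C * P B)%E) ->
  measurable_fun setT (X : g_sigma_algebraType G -> R) -> integ X ->
  \int[P]_(w in A `&` B) X w = fine (P B) * \int[P]_(w in A) X w.
Proof.
move=> GA mB PB mX iX.
have mZ : measurable_fun setT (\1_B : T -> R) by exact: measurable_indic.
pose Z : {mfun T >-> R} := HB.pack (\1_B : T -> R)
  (isMeasurableFun.Build _ _ _ _ (\1_B : T -> R) mZ).
have ZE C D : <<s G >> C -> measurable D ->
    P (C `&` Z @^-1` D) = (P C * distribution P Z D)%E.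
  move=> GC mD; have mC := G_sub GC; rewrite /distribution /pushforward.
  (* The preimage of [D] is [setT], [B], the complement of [B] or [set0], according to which of the
     values 1 and 0 lie in [D]. *)
  have -> : Z @^-1` D = [set w | (w \in B) /\ D 1 \/ (w \notin B) /\ D 0].
    apply/seteqP; split => w; rewrite /= indicE.
      by case: (boolP (w \in B)) => _ ?; [left|right].
    by case: (boolP (w \in B)) => _ [[]|[]].
  have PcB : P (C `&` ~` B) = (P C * P (~` B))%E.
    rewrite -setDE measureD// ?probability_setC//; last first.
      by rewrite (le_lt_trans (probability_le1 P mC))// ltry.
    transitivity (P C - P C * P B)%E; first by congr (_ - _)%E; exact: PB.
    by rewrite muleBr ?fin_num_measure// ?mule1// fin_num_adde_defr.
  have [D1|D1] := pselect (D 1); have [D0|D0] := pselect (D 0).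
  - rewrite [X in C `&` X](_ : _ = setT) ?setIT; last first.
      by apply/seteqP; split => // w _ /=; case: (w \in B); [left|right].
    rewrite [X in (_ * P X)%E](_ : _ = setT) ?probability_setT ?mule1//.
    by apply/seteqP; split => // w _ /=; case: (w \in B); [left|right].
  - have -> : [set w | w \in B /\ D 1 \/ w \notin B /\ D 0] = B; last by rewrite PB.
    by apply/seteqP; split => w /=; [move=> [[/set_mem]|[]]|left; split => //; apply/mem_set].
  - have -> : [set w | w \in B /\ D 1 \/ w \notin B /\ D 0] = ~` B; last by [].
    apply/seteqP; split => w /=; first by move=> [[]|[/negP wB _ Bw]]//; apply/wB/mem_set.
    by move=> wB; right; split => //; apply/negP => /set_mem.
  - have -> : [set w | w \in B /\ D 1 \/ w \notin B /\ D 0] = set0.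
      by apply/seteqP; split => w // [[]|[]].
    by rewrite setI0 measure0 mule0.
have mY : measurable_fun setT (fun z : g_sigma_algebraType G * R => X z.1 * z.2).
  apply: measurable_funM; last exact: measurable_snd.
  exact: (measurableT_comp mX measurable_fst).
have iY : integ (fun w => X w * \1_B w) by exact: integ_indic.
have := Rintegral_partial_integral mZ ZE GA mY iY => /= e.
have -> : \int[P]_(w in A `&` B) X w = \int[P]_(w in A) (X w * \1_B w).
  rewrite [RHS]Rintegral_setE Rintegral_setE; apply: eq_Rintegral => w _.
  by rewrite indicI mulrA mulrAC.
have i1B : integ (\1_B : T -> R) by exact: integrable_indic.
have mE : measurable_fun setT (EFin \o (id : R -> R)).
  by apply/measurable_EFinP; exact: measurable_id.
have iz : (distribution P Z).-integrable setT (EFin \o id).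
  exact: (integrable_pushforward mZ mE i1B measurableT).
rewrite e -RintegralZl//; [|exact: G_sub|by apply: integrableS iX => //; exact: G_sub].
apply: eq_Rintegral => w _.
rewrite RintegralZl// mulrC; congr (_ * _).
rewrite /Rintegral (integral_pushforward mZ mE i1B)//=.
by rewrite preimage_setT integral_indic// setIT.
Qed.

End independence.

(** * Grid times *)

Lemma measurable_natr_bool d (S : measurableType d) (R : realType) (b : S -> bool) :
  measurable_fun setT b -> measurable_fun setT (fun s => (b s)%:R : R).
Proof.
move=> mb; rewrite (_ : (fun s => _) = (fun s => if b s then 1 else 0 : R)).
  exact: measurable_fun_ifT.
by apply/funext => s; case: (b s).
Qed.

Section grid.
Context (R : realType) (T : R) (T_gt0 : 0 < T).
Implicit Types (t : R) (n k : nat).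

Definition grid n k : R := T * k%:R / n.+1%:R.

(** The successor of the truncation makes the grid time strictly later than [t], even when [t] is
    itself on the grid; [T] is sent to itself. *)
Definition next_grid n t : R :=
  if t < T then grid n (truncn (t * n.+1%:R / T)).+1 else T.

Lemma grid0 n : grid n 0 = 0.
Proof. by rewrite /grid mulr0 mul0r. Qed.

Lemma gridT n : grid n n.+1 = T.
Proof. by rewrite /grid mulfK// pnatr_eq0. Qed.

Lemma le_grid n k l : (k <= l)%N -> grid n k <= grid n l.
Proof.
by move=> kl; rewrite /grid ler_pM2r ?invr_gt0 ?ltr0n// ler_pM2l// ler_nat.
Qed.

Lemma grid_itv n k : (k <= n.+1)%N -> 0 <= grid n k <= T.
Proof. by 
move=> kn; apply/andP; split; [rewrite -[leLHS](grid0 n)|rewrite -[leRHS](gridT n)];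
  exact: le_grid.
Qed.

Let scale n t k : (grid n k <= t) = (k%:R <= t * n.+1%:R / T).
Proof. by rewrite /grid ler_pdivrMr ?ltr0n// ler_pdivlMr// mulrC. Qed.

Lemma next_gridE n k t : (k < n.+1)%N -> grid n k <= t < grid n k.+1 ->
  next_grid n t = grid n k.+1.
Proof.
move=> kn /andP[kt tk]; rewrite /next_grid.
rewrite (lt_le_trans tk); last by rewrite -[leRHS](gridT n) le_grid.
congr (grid n _.+1); apply: truncn_def.
by rewrite -scale kt ltNge -scale -ltNge.
Qed.

Lemma grid_dichotomy n t : 0 <= t -> t < T ->
  exists2 k, (k < n.+1)%N & grid n k <= t < grid n k.+1.
Proof.
move=> t0 tT; exists (truncn (t * n.+1%:R / T)).
  rewrite truncn_lt_nat ?divr_ge0 ?mulr_ge0 ?(ltW T_gt0)//.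
  by rewrite ltr_pdivrMr// mulrC ltr_pM2l ?ltr0n.
have /andP[] : (truncn (t * n.+1%:R / T))%:R <= t * n.+1%:R / T < (truncn (t * n.+1%:R / T)).+1%:R.
  by apply: truncn_itv; rewrite divr_ge0 ?mulr_ge0 ?(ltW T_gt0).
by rewrite -scale => ->; rewrite ltNge -scale -ltNge.
Qed.

Lemma next_gridT n t : T <= t -> next_grid n t = T.
Proof. by rewrite /next_grid leNgt => /negbTE ->. Qed.

Lemma next_grid_gt n t : 0 <= t -> t < T -> t < next_grid n t.
Proof.
move=> t0 tT; have [k kn kt] := grid_dichotomy n t0 tT.
by rewrite (next_gridE kn kt); case/andP : kt.
Qed.

Lemma next_grid_le n t : 0 <= t -> t < T -> next_grid n t <= t + T / n.+1%:R.
Proof.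
move=> t0 tT; have [k kn kt] := grid_dichotomy n t0 tT.
rewrite (next_gridE kn kt); case/andP : kt => kt _.
rewrite {1}/grid -natr1 mulrDr mulrDl mulr1 lerD2r; exact: kt.
Qed.

Lemma next_grid_itv n t : 0 <= t <= T -> 0 <= next_grid n t <= T.
Proof.
move=> /andP[t0 tT]; have [Tt|{}tT] := leP T t; first by rewrite next_gridT// lexx (ltW T_gt0).
have [k kn kt] := grid_dichotomy n t0 tT.
by rewrite (next_gridE kn kt) grid_itv.
Qed.

Lemma next_grid_cvg t : 0 <= t <= T -> next_grid n t @[n --> \oo] --> t.
Proof.
move=> /andP[t0 tT]; have [Tt|{}tT] := leP T t.
  have -> : t = T by apply/eqP; rewrite eq_le tT.
  by apply: cvg_near_cst; apply: nearW => n; exact: next_gridT.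
apply: (@squeeze_cvgr _ _ _ _ (cst t) (fun n => t + T / n.+1%:R)).
- by apply: nearW => n; rewrite (ltW (next_grid_gt n t0 tT)) next_grid_le.
- exact: cvg_cst.
- rewrite -[X in _ --> X]addr0; apply: cvgD; first exact: cvg_cst.
  rewrite -(mulr0 T); apply: cvgM; first exact: cvg_cst.
  exact: cvg_harmonic.
Qed.

(** Before [T] the approximating times lie strictly to the right of [t], so the right limit applies;
    at [T] the sequence is constant. *)
Lemma cadlag_next_grid (a : R -> R) t : cadlag T a -> 0 <= t <= T ->
  a (next_grid n t) @[n --> \oo] --> a t.
Proof.
move=> [rca _] /andP[t0 tT]; have [Tt|{}tT] := leP T t.
  have -> : t = T by apply/eqP; rewrite eq_le tT.
  by apply: cvg_near_cst; apply: nearW => n; rewrite next_gridT.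
have /rca/cvg_at_rightP : 0 <= t < T by rewrite t0.
apply.
by split=> [n|]; [exact: next_grid_gt|apply: next_grid_cvg; rewrite t0 ltW].
Qed.

(** A sum over all cells, with weights that only ask whether [t] has reached [grid n k], turns
    sampling at a random time into finitely many events and deterministic times. *)
Lemma next_grid_telescope (phi : R -> R) n t : 0 <= t <= T ->
  phi (next_grid n t) = phi 0 +
  \sum_(k < n.+1) (phi (grid n k.+1) - phi (grid n k)) * (grid n k <= t)%R%:R.
Proof.
move=> /andP[t0 tT].
(* [K] is the cell containing [t]; for [t = T] it is the last one, [n]. *)
have [K Kn [-> Kt]] : exists2 K, (K < n.+1)%N & next_grid n t = grid n K.+1 /\
    forall k, (k < n.+1)%N -> (grid n k <= t) = (k <= K)%N.
  have [Tt|{}tT] := leP T t.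
    exists n => //; rewrite next_gridT// gridT; split=> // k kn.
    by rewrite -ltnS kn (le_trans _ Tt)//; have /andP[] := grid_itv (ltnW kn).
  have [K Kn Kt] := grid_dichotomy n t0 tT.
  exists K => //; rewrite (next_gridE Kn Kt); split=> // k kn.
  case/andP : Kt => Kt tK; have [kK|Kk] := leqP k K.
    by rewrite (le_trans _ Kt)// le_grid.
  by apply/negbTE; rewrite -ltNge (lt_le_trans tK)// le_grid.
(* Beyond [K] the weights vanish, so the partial sums stop growing at [K.+1]. *)
have S m : (m <= n.+1)%N ->
    \sum_(k < m) (phi (grid n k.+1) - phi (grid n k)) * (grid n k <= t)%R%:R =
    phi (grid n (minn m K.+1)) - phi 0.
  elim: m => [_|m ih mn]; first by rewrite big_ord0 min0n grid0 subrr.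
  rewrite big_ord_recr/= ih ?(ltnW mn)// Kt//; have [mK|Km] := leqP m K.
    have -> : minn m K.+1 = m by apply/minn_idPl/leqW.
    have -> : minn m.+1 K.+1 = m.+1 by exact/minn_idPl.
    by rewrite /=; ring.
  have -> : minn m K.+1 = K.+1 by exact/minn_idPr.
  have -> : minn m.+1 K.+1 = K.+1 by apply/minn_idPr; rewrite ltnS ltnW.
  by rewrite /=; ring.
by rewrite S// (minn_idPr _)// addrC subrK.
Qed.

(** The telescoped sum involves [X] at grid times only, so measurability at each fixed time
    suffices. *)
Lemma measurable_next_grid_sample d (S : measurableType d) (tau : S -> R)
    (X : R -> S -> R) n :
  measurable_fun setT tau -> (forall s, 0 <= tau s <= T) ->
  (forall t, 0 <= t <= T -> measurable_fun setT (X t)) ->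
  measurable_fun setT (fun s => X (next_grid n (tau s)) s).
Proof.
move=> mtau tau0T mX.
under eq_fun => s do rewrite (next_grid_telescope (X ^~ s) n (tau0T s)).
apply: measurable_funD; first by apply: mX; rewrite lexx ltW.
apply: measurable_sum => k; apply: measurable_funM.
  by apply: measurable_funB; apply: mX; rewrite grid_itv// ltnW.
by apply: measurable_natr_bool; exact: measurable_fun_ler.
Qed.

(** Right-continuity makes the sample a pointwise limit of grid samples. *)
Lemma measurable_cadlag_sample d (S : measurableType d) (tau : S -> R)
    (X : R -> S -> R) :
  measurable_fun setT tau -> (forall s, 0 <= tau s <= T) ->
  (forall t, 0 <= t <= T -> measurable_fun setT (X t)) ->
  (forall s, cadlag T (X ^~ s)) ->
  measurable_fun setT (fun s => X (tau s) s).
Proof.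
move=> mtau tau0T mX cX.
apply: (@measurable_fun_cvg _ _ _ _ (fun n s => X (next_grid n (tau s)) s)).
  by move=> n; exact: measurable_next_grid_sample.
by move=> s _; exact: (cadlag_next_grid (cX s)).
Qed.

End grid.

Lemma measurable_payoff (R : realType) (T : R) d (S : measurableType d)
    (f h g : R -> S -> R) (tau sigma : S -> R) : 0 < T ->
  (forall t, 0 <= t <= T -> [/\ measurable_fun setT (f t),
     measurable_fun setT (h t) & measurable_fun setT (g t)]) ->
  (forall s, [/\ cadlag T (f ^~ s), cadlag T (h ^~ s) & cadlag T (g ^~ s)]) ->
  measurable_fun setT tau -> measurable_fun setT sigma ->
  (forall s, 0 <= tau s <= T) -> (forall s, 0 <= sigma s <= T) ->
  measurable_fun setT (payoff f h g tau sigma).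
Proof.
move=> T_gt0 mX cX mtau msigma tauT sigmaT.
apply: measurable_funD; first apply: measurable_funD.
- apply: measurable_funM.
    by apply: (measurable_cadlag_sample T_gt0) => // [t /mX[]|s]//; case: (cX s).
  by apply: measurable_natr_bool; exact: measurable_fun_ltr.
- apply: measurable_funM.
    by apply: (measurable_cadlag_sample T_gt0) => // [t /mX[]|s]//; case: (cX s).
  by apply: measurable_natr_bool; exact: measurable_fun_eqr.
- apply: measurable_funM.
    by apply: (measurable_cadlag_sample T_gt0) => // [t /mX[]|s]//; case: (cX s).
  by apply: measurable_natr_bool; exact: measurable_fun_ltr.
Qed.

(** * Passing from grid times to arbitrary times *)

Section payoff_approximation.
Context d (Om : measurableType d) (R : realType) (P : probability Om R).
Context (T : R) (T_gt0 : 0 < T).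
Local Notation integ X := (P.-integrable setT (EFin \o X)).

(** One bound serves all times; it is extended-valued, as the supremum in [payoff_process] is. *)
Definition dominated_process (D : Om -> \bar R) (X : R -> Om -> R) :=
  [/\ forall t, 0 <= t <= T -> measurable_fun setT (X t),
      forall w, cadlag T (X ^~ w) &
      forall t w, 0 <= t <= T -> (`|X t w|%:E <= D w)%E].

Context (D : Om -> \bar R) (D_int : P.-integrable setT D).
Implicit Types (f h g : R -> Om -> R) (tau sigma : Om -> R).

Let measurable_dominated_payoff f h g tau sigma :
  dominated_process D f -> dominated_process D h -> dominated_process D g ->
  measurable_fun setT tau -> measurable_fun setT sigma ->
  (forall w, 0 <= tau w <= T) -> (forall w, 0 <= sigma w <= T) ->
  measurable_fun setT (payoff f h g tau sigma).
Proof.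
move=> [mf cf _] [mh ch _] [mg cg _] mtau msigma tauT sigmaT.
apply: (measurable_payoff T_gt0) => // t tT; split; [exact: mf|exact: mh|exact: mg].
Qed.

Lemma payoff_leD f h g tau sigma w :
  dominated_process D f -> dominated_process D h -> dominated_process D g ->
  0 <= tau w <= T -> 0 <= sigma w <= T ->
  (`|payoff f h g tau sigma w|%:E <= D w)%E.
Proof.
move=> [_ _ fD] [_ _ hD] [_ _ gD] tauT sigmaT; rewrite /payoff.
by case: (ltgtP (tau w) (sigma w)) => _; rewrite !(mulr0,mulr1,addr0,add0r);
  [exact: fD|exact: gD|exact: hD].
Qed.

Lemma integrable_payoff f h g tau sigma :
  dominated_process D f -> dominated_process D h -> dominated_process D g ->
  measurable_fun setT tau -> measurable_fun setT sigma ->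
  (forall w, 0 <= tau w <= T) -> (forall w, 0 <= sigma w <= T) ->
  integ (payoff f h g tau sigma).
Proof.
move=> Df Dh Dg mtau msigma tauT sigmaT; apply: (le_integrable _ _ _ D_int) => //.
  by apply/measurable_EFinP; exact: measurable_dominated_payoff.
move=> w _ /=; apply: le_trans (lee_abs _).
exact: payoff_leD.
Qed.

(* Delaying [tau] to the next grid time only matters in the limit on
   [tau = sigma < T], where [h] is replaced by [g <= h]. *)
Lemma payoff_next_grid_le f h g tau sigma (v : R) :
  dominated_process D f -> dominated_process D h -> dominated_process D g ->
  {ae P, forall w, forall t, 0 <= t <= T -> g t w <= h t w} ->
  measurable_fun setT tau -> measurable_fun setT sigma ->
  (forall w, 0 <= tau w <= T) -> (forall w, 0 <= sigma w <= T) ->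
  (forall n, v <= \int[P]_w payoff f h g (next_grid T n \o tau) sigma w) ->
  v <= \int[P]_w payoff f h g tau sigma w.
Proof.
move=> Df Dh Dg gh mtau msigma tauT sigmaT vn.
(* For large [n] the delayed time keeps its strict order with [sigma], and a tie at [T] survives
   since [T] is its own next grid time; [L] is the resulting limit. *)
pose L := payoff f (fun t w => if t < T then g t w else h t w) g tau sigma.
have mtaun n : measurable_fun setT (next_grid T n \o tau).
  exact: (measurable_next_grid_sample T_gt0 (X := fun t _ => t)).
have taunT n w : 0 <= (next_grid T n \o tau) w <= T by exact: next_grid_itv.
have cL w : payoff f h g (next_grid T n \o tau) sigma w @[n --> \oo] --> L w.
  have [_ /(_ w) cf _] := Df; have [_ /(_ w) ch _] := Dh.
  have := tauT w => /andP[tau0 tau1].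
  have ctau := next_grid_cvg T_gt0 (tauT w).
  rewrite /L {2}/payoff; case: (ltgtP (tau w) (sigma w)) => [ts|st|e].
  - rewrite !(mulr0,mulr1,addr0,add0r).
    apply: cvg_trans (cadlag_next_grid T_gt0 cf (tauT w)).
    apply: near_eq_cvg; near=> n.
    have nts : next_grid T n (tau w) < sigma w.
      by near: n; exact: (cvgr_lt (tau w)).
    by rewrite /payoff/= nts ltNge (ltW nts) lt_eqF// !(mulr0,mulr1,addr0).
  - rewrite !(mulr0,mulr1,addr0,add0r).
    apply: cvg_near_cst; apply: nearW => n.
    have stn : sigma w < next_grid T n (tau w).
      apply: (lt_le_trans st); have [tT|Tt] := ltP (tau w) T.
        by rewrite ltW// next_grid_gt.
      by rewrite next_gridT.
    by rewrite /payoff/= stn ltNge (ltW stn) gt_eqF// !(mulr0,mulr1,add0r).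
  - rewrite !(mulr0,mulr1,addr0,add0r); have [tT|Tt] := ltP (tau w) T.
      apply: cvg_near_cst; apply: nearW => n.
      have stn : sigma w < next_grid T n (tau w) by rewrite -e next_grid_gt.
      by rewrite e /payoff/= stn ltNge (ltW stn) gt_eqF// !(mulr0,mulr1,add0r).
    apply: cvg_near_cst; apply: nearW => n.
    have eT : tau w = T by apply/eqP; rewrite eq_le tau1.
    by rewrite /payoff/= next_gridT// -e eT ltxx eqxx !(mulr0,mulr1,add0r,addr0).
have mL : measurable_fun setT L.
  apply: (@measurable_fun_cvg _ _ _ _
    (fun n w => payoff f h g (next_grid T n \o tau) sigma w)) => //.
  by move=> n; exact: measurable_dominated_payoff.
have [|||//||iL _ cvgL] := @dominated_convergence _ _ _ P setT measurableT
  (fun n w => (payoff f h g (next_grid T n \o tau) sigma w)%:E) (EFin \o L) D.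
- by move=> n; apply/measurable_EFinP; exact: measurable_dominated_payoff.
- exact/measurable_EFinP.
- by apply: aeW => w _; apply/fine_cvgP; split; [exact: nearW|exact: cL].
- by apply: aeW => w n _; exact: payoff_leD.
apply: (@le_trans _ _ (\int[P]_w L w)).
  rewrite -lee_fin /Rintegral fineK; last exact: integrable_fin_num.
  apply: (cvge_ge _ cvgL); apply: nearW => n.
  rewrite -[leRHS]fineK; first exact: vn.
  by apply: integrable_fin_num => //; exact: integrable_payoff.
apply: ae_le_Rintegral => //; first exact: integrable_payoff.
apply: filterS gh => w gh; rewrite /L /payoff.
rewrite lerD2r lerD2l ler_wpM2r//; case: ifP => // _; exact: gh.
Unshelve. all: by end_near. Qed.

End payoff_approximation.

(** * Randomised times as generalised inverses *)

Section crossing.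
Context (R : realType) (T : R) (T_gt0 : 0 < T).
Implicit Types (a : R -> R) (z t : R).

(** The generalised inverse of the path [a]. By unfolding, [generated_time] is this function along
    the paths of [rho], so that facts about a single path apply to it. *)
Definition crossing a z : R := inf [set t | 0 <= t <= T /\ z < a t].

Lemma crossing_itv a z : 0 <= crossing a z <= T.
Proof.
rewrite /crossing; set S := [set _ | _].
have [->|/set0P [t St]] := eqVneq S set0; first by rewrite inf0 lexx ltW.
have S0 : lbound S 0 by move=> s [/andP[]].
rewrite lb_le_inf//=; last by exists t.
have [/andP[_ tT] _] := St.
by apply: le_trans tT; apply: ge_inf => //; exists 0.
Qed.

Lemma generating_path_le1 a t : generating_path T a -> 0 <= t <= T -> 0 <= a t <= 1.
Proof.
move=> [_ a0 nda aT] /andP[t0 tT].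
by rewrite (le_trans a0) ?nda//= -aT nda.
Qed.

(** For [z < 1] the time [T], where [a] equals 1, belongs to the set defining [crossing], so the
    infimum is that of a nonempty set. *)
Lemma crossing_lt a z t : generating_path T a -> z < 1 -> t <= T ->
  crossing a z < t <-> exists s, [/\ 0 <= s, s < t & z < a s].
Proof.
move=> ga z1 tT; split.
  move=> /inf_lt[]; first by exists T => /=; split; [rewrite lexx ltW|case: ga => _ _ _ ->].
  by move=> s [/andP[s0 _] zs] st; exists s.
move=> [s [s0 st zs]]; apply: le_lt_trans (st); apply: ge_inf.
  by exists 0 => u [/andP[]].
by split => //; rewrite s0 (ltW (lt_le_trans st tT)).
Qed.

(** No value of [a] exceeds 1, so the infimum is that of the empty set, 0 by convention. *)
Lemma crossing_ge1 a z : generating_path T a -> 1 <= z -> crossing a z = 0.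
Proof.
move=> ga z1; rewrite /crossing [X in inf X](_ : _ = set0) ?inf0//.
apply/seteqP; split => // t [/(generating_path_le1 ga)/andP[_ at1]].
by rewrite ltNge (le_trans at1).
Qed.

(** Monotonicity lets the witness move up to a rational time still before [t], which leaves a
    countable union of events at times strictly before [t]. For [1 <= Z s] the default value 0 of
    the infimum lies below [t]. *)
Lemma crossing_ltE S (rho : R -> S -> R) (Z : S -> R) t :
  (forall s, generating_path T (rho ^~ s)) -> 0 < t <= T ->
  [set s | crossing (rho ^~ s) (Z s) < t] =
  [set s | 1 <= Z s] `|`
  \bigcup_(q in [set q : rat | 0 <= ratr q :> R /\ ratr q < t]) [set s | Z s < rho (ratr q) s].
Proof.
move=> ga /andP[t0 tT]; apply/seteqP; split => s /=.
  have [Z1|Z1] := leP 1 (Z s); first by left.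
  move=> /(crossing_lt (ga s) Z1 tT)[u [u0 ut Zu]]; right.
  have [q] := rat_in_itvoo ut; rewrite in_itv/= => /andP[uq qt].
  exists q => /=; first by rewrite (le_trans u0 (ltW uq)) qt.
  have [_ _ nda _] := ga s.
  by apply: (lt_le_trans Zu); apply: nda; rewrite ?(ltW (lt_le_trans qt tT))// ltW.
have [Z1 _|Z1] := leP 1 (Z s); first by rewrite (crossing_ge1 (ga s) Z1).
move=> []; [by []|move=> [q [q0 qt] Zq]]; apply/(crossing_lt (ga s)) => //.
by exists (ratr q).
Qed.

Lemma measurable_crossing d (S : measurableType d) (rho : R -> S -> R)
    (Z : S -> R) :
  (forall s, generating_path T (rho ^~ s)) ->
  (forall t, 0 <= t <= T -> measurable_fun setT (rho t)) ->
  measurable_fun setT Z ->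
  measurable_fun setT (fun s => crossing (rho ^~ s) (Z s)).
Proof.
move=> ga mrho mZ; apply: (measurability _ (RGenInftyO.measurableE R)) => //.
move=> _ [_ [t ->] <-]; rewrite setTI.
have [t0|t0] := leP t 0.
  rewrite [X in measurable X](_ : _ = set0)//; apply/seteqP; split => // s /=.
  by rewrite in_itv/= ltNge (le_trans t0)//; have /andP[] := crossing_itv (rho ^~ s) (Z s).
have [Tt|tT] := ltP T t.
  rewrite [X in measurable X](_ : _ = setT)//; apply/seteqP; split => // s _ /=.
  by rewrite in_itv/= (le_lt_trans _ Tt)//; have /andP[] := crossing_itv (rho ^~ s) (Z s).
rewrite [X in measurable X](_ : _ = [set s | crossing (rho ^~ s) (Z s) < t]); last first.
  by apply/seteqP; split => s /=; rewrite in_itv.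
rewrite crossing_ltE ?t0//; apply: measurableU.
  rewrite -[X in measurable X]setTI; exact: measurable_fun_ler.
rewrite bigcup_mkcond; apply: bigcupT_measurable_rat => q.
case: ifPn => // /set_mem[q0 qt].
rewrite -[X in measurable X]setTI; apply: measurable_fun_ltr => //.
by apply: mrho; rewrite q0 (ltW (lt_le_trans qt _)).
Qed.

End crossing.

(** * The image of the uniform law under a generalised inverse *)

Section crossing_law.
Context (R : realType) (T : R) (T_gt0 : 0 < T).
Implicit Types (t z : R).
Local Notation unif := (uniform_prob (@ltr01 R)).
Local Notation left_lim := (@left_lim R).

Lemma uniform_prob_ray (b : bool) (c : R) : 0 <= c <= 1 ->
  unif [set` Interval -oo%O (BSide b c)] = c%:E.
Proof.
move=> /andP[c0 c1]; rewrite /uniform_prob integral_uniform_pdf.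
rewrite (_ : _ `&` _ = [set` Interval (BLeft 0) (BSide b c)]); last first.
  apply/seteqP; split => x /=; rewrite !in_itv/=.
    by move=> [xc /andP[x0 x1]]; rewrite x0.
  move=> /andP[x0 xc]; rewrite x0; split => //=; apply: le_trans c1.
  by move: xc {c0}; case: b => //= /ltW.
rewrite (eq_integral (cst 1%:E)); last first.
  move=> x; rewrite inE/= in_itv/= /uniform_pdf => /andP[x0 xc].
  rewrite x0 (_ : x <= 1) ?subr0 ?invr1//; apply: le_trans c1.
  by move: xc {c0}; case: b => //= /ltW.
rewrite integral_cst//= mul1e lebesgue_measure_itv/= lte_fin sube0.
by move: c0; rewrite le_eqVlt => /predU1P[<-|->]//; rewrite ltxx.
Qed.

Lemma left_lim_cvg (a : R -> R) t : generating_path T a -> 0 < t <= T ->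
  a s @[s --> t^'-] --> left_lim a t.
Proof.
move=> [[_ la] _ _ _] /[dup] t0T /andP[t0 _]; rewrite /left_lim leNgt t0/=.
exact: la.
Qed.

Lemma left_lim_ge (a : R -> R) s t : generating_path T a ->
  0 <= s -> s < t -> t <= T -> a s <= left_lim a t.
Proof.
move=> ga s0 st tT; have [_ _ nda _] := ga.
have t0 := le_lt_trans s0 st.
have cl : a s @[s --> t^'-] --> left_lim a t by apply: left_lim_cvg; rewrite ?t0.
rewrite -(cvg_lim (@Rhausdorff R) cl); apply: limr_ge; first exact: cvgP cl.
near=> u; apply: nda => //.
  by apply: ltW; near: u; exact: nbhs_left_gt.
apply: le_trans tT; apply: ltW; near: u; exact: nbhs_left_lt.
Unshelve. all: by end_near. Qed.

Lemma left_lim_le (a : R -> R) t : generating_path T a -> 0 <= t <= T ->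
  left_lim a t <= a t.
Proof.
move=> ga /andP[t0 tT]; have [_ a0 nda _] := ga.
move: t0; rewrite le_eqVlt => /predU1P[<-|t0]; first by rewrite /left_lim lexx.
have cl : a s @[s --> t^'-] --> left_lim a t by apply: left_lim_cvg; rewrite ?t0.
rewrite -(cvg_lim (@Rhausdorff R) cl); apply: limr_le; first exact: cvgP cl.
near=> u; apply: nda => //.
by apply: ltW; near: u; exact: nbhs_left_gt.
Unshelve. all: by end_near. Qed.

Lemma left_lim_ge0 (a : R -> R) t : generating_path T a -> 0 <= t <= T ->
  0 <= left_lim a t.
Proof.
move=> ga /andP[t0 tT]; have [_ a0 nda _] := ga.
move: t0; rewrite le_eqVlt => /predU1P[<-|t0]; first by rewrite /left_lim lexx.
by apply: (le_trans a0); exact: left_lim_ge.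
Qed.

Lemma left_lim_gt (a : R -> R) t z : generating_path T a -> 0 <= z -> 0 <= t <= T ->
  z < left_lim a t -> exists s, [/\ 0 <= s, s < t & z < a s].
Proof.
move=> ga z0 /andP[t0 tT] zt.
(* At [t = 0] the conventional left limit 0 would force [z < 0]. *)
have {}t0 : 0 < t.
  by rewrite lt_neqAle t0 andbT; apply/eqP => t0'; move: zt; rewrite -t0' /left_lim lexx ltNge z0.
have ca : a s @[s --> t^'-] --> left_lim a t by apply: left_lim_cvg => //; rewrite t0.
have za : \forall s \near t^'-, z < a s by exact: cvgr_gt ca _ zt.
have [s [zs s0 st]] : exists s, [/\ z < a s, 0 < s & s < t].
  apply: (@filter_ex _ t^'-); near=> s; split; near: s => //.
    exact: nbhs_left_gt.
  exact: nbhs_left_lt.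
by exists s; rewrite ltW.
Unshelve. all: by end_near. Qed.

Section law.
Context (a : R -> R) (ga : generating_path T a).

Lemma measurable_crossing_path : measurable_fun setT (crossing T a).
Proof.
apply: (@measurable_crossing _ _ T_gt0 _ _ (fun t _ => a t) id) => //.
Qed.

Lemma uniform_prob_lt0 : unif `]-oo, 0[ = 0%E.
Proof. by rewrite uniform_prob_ray ?lexx ?ler01. Qed.

Lemma uniform_prob_ge1 : unif `[1, +oo[ = 0%E.
Proof.
rewrite -setCitvl probability_setC//.
transitivity (1 - 1%:E : \bar R)%E; last by rewrite subee.
by congr (_ - _)%E; apply: (uniform_prob_ray true); rewrite lexx ler01.
Qed.

(** Up to a set of uniform measure 0, [A] lies between the open and the closed ray ending at [c],
    which have the same mass; membership of [c] itself and of points outside [[0, 1[] is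
    immaterial. *)
Lemma uniform_prob_sandwich (A : set R) (c : R) : measurable A -> 0 <= c <= 1 ->
  (forall z, 0 <= z < 1 -> z < c -> A z) -> (forall z, 0 <= z < 1 -> A z -> z <= c) ->
  unif A = c%:E.
Proof.
move=> mA c01 cA Ac.
pose N : set R := `]-oo, 0[ `|` `[1, +oo[.
have mN : measurable N by exact: measurableU.
have e0 : unif N = 0%E.
  by apply/null_set_setU => //; [exact: uniform_prob_lt0|exact: uniform_prob_ge1].
have le_union (B C : set R) : measurable B -> measurable C ->
    (forall z, 0 <= z < 1 -> B z -> C z) -> (unif B <= unif C)%E.
  move=> mB mC BC; apply: (@le_trans _ _ (unif (C `|` N))).
    apply: le_measure; rewrite ?inE//; first exact: measurableU.
    move=> z Bz; have [z0|z0] := ltP z 0; first by right; left; rewrite /= in_itv.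
    have [z1|z1] := ltP z 1; last by right; right; rewrite /= in_itv/= z1.
    by left; apply: BC => //; rewrite z0.
  apply: (@le_trans _ _ (unif C + unif N)%E).
    exact: measureU2.
  by rewrite e0 adde0.
apply/eqP; rewrite eq_le; apply/andP; split.
  by rewrite -(uniform_prob_ray false c01); exact: le_union.
by rewrite -(uniform_prob_ray true c01); exact: le_union.
Qed.

Let measurable_lt t : measurable [set z | crossing T a z < t].
Proof.
rewrite -[X in measurable X]setTI; apply: measurable_fun_ltr => //.
exact: measurable_crossing_path.
Qed.

Let measurable_le t : measurable [set z | crossing T a z <= t].
Proof.
rewrite -[X in measurable X]setTI; apply: measurable_fun_ler => //.
exact: measurable_crossing_path.
Qed.

Lemma crossing_prob_lt t : 0 <= t <= T ->
  unif [set z | crossing T a z < t] = (left_lim a t)%:E.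
Proof.
move=> /[dup] t0T /andP[t0 tT]; apply: uniform_prob_sandwich => //.
- rewrite left_lim_ge0//=; apply: le_trans (left_lim_le ga t0T) _.
  by have /andP[] := generating_path_le1 ga t0T.
- move=> z /andP[z0 z1] zt; apply/(crossing_lt T_gt0) => //.
  exact: left_lim_gt.
- move=> z /andP[z0 z1] /(crossing_lt T_gt0 ga z1 tT)[s [s0 st zs]].
  by rewrite (le_trans (ltW zs))// left_lim_ge.
Qed.

Lemma crossing_prob_le t : 0 <= t <= T ->
  unif [set z | crossing T a z <= t] = (a t)%:E.
Proof.
move=> /[dup] t0T /andP[t0 tT]; apply: uniform_prob_sandwich => //.
- exact: generating_path_le1 ga t0T.
- move=> z /andP[z0 z1] zt /=; apply: ge_inf; last by rewrite /= t0T.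
  by exists 0 => u [/andP[]].
move=> z /andP[z0 z1] /= zt.
have [Tt|{}tT] := leP T t.
  have -> : t = T by apply/eqP; rewrite eq_le tT.
  by case: ga => _ _ _ ->; exact: ltW.
have [[rca _] _ nda _] := ga.
have ca : a s @[s --> t^'+] --> a t by apply: rca; rewrite t0.
(* Every [s] in []t, T]] is preceded by a time [u] with [z < a u <= a s]; letting [s] decrease to
   [t] gives [z <= a t] by right-continuity. *)
rewrite -(cvg_lim (@Rhausdorff R) ca); apply: limr_ge; first exact: cvgP ca.
near=> s.
have ts : t < s by near: s; exact: nbhs_right_gt.
have sT : s <= T by near: s; exact: nbhs_right_le.
have [u [u0 us zu]] : exists u, [/\ 0 <= u, u < s & z < a u].
  by apply/(crossing_lt T_gt0 ga z1 sT); exact: le_lt_trans ts.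
by rewrite (le_trans (ltW zu))// nda// ltW.
Unshelve. all: by end_near. Qed.

(** The path extended by 0 before time 0 and by its final value after [T] is the distribution
    function of [crossing] on the whole line, an atom at 0 included. *)
Lemma crossing_cdf t :
  unif [set z | crossing T a z <= t] = (extend_path T a t)%:E.
Proof.
rewrite /extend_path; have [t0|t0] := ltP t 0.
  rewrite [X in unif X](_ : _ = set0) ?measure0//; apply/seteqP; split => // z /=.
  by rewrite leNgt (lt_le_trans t0)//; have /andP[] := crossing_itv T_gt0 a z.
have [Tt|tT] := leP T t.
  rewrite ?(min_idPr Tt); case: (ga) => _ _ _ ->.
  rewrite [X in unif X](_ : _ = setT) ?probability_setT//.
  apply/seteqP; split => // z _ /=; apply: le_trans Tt.
  by have /andP[] := crossing_itv T_gt0 a z.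
by rewrite ?(min_idPl (ltW tT)) crossing_prob_le// t0 ltW.
Qed.

(** Both measures give []x, y]] the increment of the extended path, and a Lebesgue-Stieltjes measure
    is determined by these intervals. *)
Lemma stieltjes_crossing (A : set R) : measurable A ->
  stieltjes T a A = pushforward unif (crossing T a) A.
Proof.
move=> mA; have [nd [rc ->]] := stieltjesE (ltW T_gt0) ga.
pose X : {mfun measurableTypeR R >-> measurableTypeR R} := HB.pack
  (crossing T a : measurableTypeR R -> measurableTypeR R)
  (isMeasurableFun.Build _ _ _ _ (crossing T a : measurableTypeR R -> measurableTypeR R)
    measurable_crossing_path).
apply: (lebesgue_stieltjes_measure_unique (mu := distribution unif X)) => // I [[x y]]/= _ <-.
rewrite /lebesgue_stieltjes_measure /measure_extension/=.
rewrite measurable_mu_extE/=; last exact: is_ocitv.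
have [xy|yx] := leP x y; last first.
  by rewrite set_itv_ge ?wlength0 ?measure0// bnd_simp -leNgt ltW.
rewrite wlength_itv_bnd// /mk_cumulative EFinB -!crossing_cdf.
rewrite /distribution /pushforward.
have -> : crossing T a @^-1` `]x, y] =
    [set z | crossing T a z <= y] `\` [set z | crossing T a z <= x].
  apply/seteqP; split => z /=; rewrite in_itv/=.
    by move=> /andP[xz zy]; split => //; apply/negP; rewrite -ltNge.
  by move=> [-> /negP]; rewrite -ltNge => ->.
have ley : (unif [set z | (crossing T a z <= y)%R] < +oo)%E.
  by rewrite crossing_cdf ltry.
have := measureD (mu := unif) (measurable_le y) (measurable_le x) ley.
by rewrite setIidr => [/esym //|z /= zx]; exact: (le_trans zx).
Qed.

End law.

Lemma Rintegral_stieltjes_crossing (a g : R -> R) (M : R) t :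
  generating_path T a -> cadlag T g ->
  (forall s, 0 <= s <= T -> `|g s| <= M) -> t <= T ->
  \int[stieltjes T a]_(s in `[0, t[) g s =
  \int[unif]_z (g (crossing T a z) * (crossing T a z < t)%R%:R).
Proof.
move=> ga cg gM tT; have mc := measurable_crossing_path ga.
(* [g] is constrained on [[0, T]] only; clamping the argument makes it measurable and bounded on the
   whole line without altering it on [[0, t[]. *)
pose clamp s := Num.max 0 (Num.min s T).
have clamp_itv s : 0 <= clamp s <= T.
  by rewrite /clamp le_max lexx/= ge_max (ltW T_gt0) ge_min lexx orbT.
have mg : measurable_fun setT (fun s => g (clamp s)).
  apply: (measurable_cadlag_sample T_gt0 (X := fun t _ => g t)) => //.
  by apply: measurable_maxr => //; exact: measurable_minr.
pose G s := g (clamp s) * \1_(`[0, t[ : set R) s.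
have mG : measurable_fun setT G by apply: measurable_funM => //; exact: measurable_indic.
have GE s : (g \_ (`[0, t[ : set R)) s = G s.
  rewrite /patch /G indicE; case: ifPn => [|_]; last by rewrite mulr0.
  rewrite mulr1 inE/= in_itv/= => /andP[s0 st].
  by rewrite /clamp (min_idPl _) ?(max_idPr _)//; apply: ltW; exact: lt_le_trans tT.
have GM s : `|G s| <= M.
  rewrite /G normrM -[leRHS]mulr1 ler_pM//; first exact: gM.
  by rewrite indicE; case: (_ \in _); rewrite ?normr1 ?normr0.
rewrite Rintegral_mkcond; transitivity (\int[stieltjes T a]_s G s).
  by apply: eq_Rintegral => s _; exact: GE.
rewrite /Rintegral; congr fine.
pose X : {mfun measurableTypeR R >-> measurableTypeR R} := HB.pack
  (crossing T a : measurableTypeR R -> measurableTypeR R)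
  (isMeasurableFun.Build _ _ _ _ (crossing T a : measurableTypeR R -> measurableTypeR R) mc).
transitivity (\int[distribution unif X]_s (G s)%:E)%E.
  by apply: eq_measure_integral => A mA _; exact: stieltjes_crossing.
have mEG : measurable_fun setT (EFin \o (G : measurableTypeR R -> R)).
  exact/measurable_EFinP.
have mX : measurable_fun setT X by exact: mc.
have iG : unif.-integrable setT ((EFin \o G) \o X).
  by apply: (integ_bounded _ (M := M)) => //; exact: measurableT_comp mG mX.
apply: etrans (integral_pushforward mX mEG iG measurableT) _.
rewrite preimage_setT; apply: eq_integral => z _ /=; congr EFin; rewrite /G.
have /andP[c0 cT] := crossing_itv T_gt0 a z.
rewrite /clamp ?(min_idPl cT) ?(max_idPr c0); congr (_ * _).
rewrite indicE; case: ltP => ct; first by rewrite mem_set//= in_itv/= c0.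
by rewrite memNset//= in_itv/= c0 ltNge ct.
Qed.

Lemma payoff_crossing (a f h g : R -> R) (M : R) t : generating_path T a ->
  cadlag T g -> (forall s, 0 <= s <= T -> `|g s| <= M) -> 0 <= t <= T ->
  \int[unif]_z (f t * (t < crossing T a z)%R%:R + h t * (t == crossing T a z)%:R
      + g (crossing T a z) * (crossing T a z < t)%R%:R) =
  \int[stieltjes T a]_(s in `[0, t[) g s + f t * (1 - a t) + h t * jump a t.
Proof.
move=> ga cg gM /[dup] t0T /andP[t0 tT]; have mc := measurable_crossing_path ga.
have mlt : measurable_fun setT (fun z => crossing T a z < t) by exact: measurable_fun_ltr.
have mle : measurable_fun setT (fun z => crossing T a z <= t) by exact: measurable_fun_ler.
rewrite (Rintegral_stieltjes_crossing ga cg gM tT).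
pose X1 z : R := (crossing T a z <= t)%R%:R; pose X2 z : R := (crossing T a z < t)%R%:R.
pose X3 z := g (crossing T a z) * X2 z.
have i1 : unif.-integrable setT (EFin \o X1).
  apply: (integ_bounded _ (M := 1)); first exact: measurable_natr_bool.
  by move=> z; rewrite /X1; case: (crossing T a z <= t); rewrite ?normr1 ?normr0 ?ler01.
have i2 : unif.-integrable setT (EFin \o X2).
  apply: (integ_bounded _ (M := 1)); first exact: measurable_natr_bool.
  by move=> z; rewrite /X2; case: (crossing T a z < t); rewrite ?normr1 ?normr0 ?ler01.
have i3 : unif.-integrable setT (EFin \o X3).
  apply: (integ_bounded _ (M := M)).
    apply: measurable_funM; last exact: measurable_natr_bool.
    apply: (measurable_cadlag_sample T_gt0 (X := fun t _ => g t)) => // z.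
    exact: crossing_itv.
  move=> z; rewrite /X3 normrM -[leRHS]mulr1 ler_pM//; first exact/gM/crossing_itv.
  by rewrite /X2; case: (crossing T a z < t); rewrite ?normr1 ?normr0 ?ler01.
have e1 : \int[unif]_z X1 z = a t.
  transitivity (fine (unif [set z | crossing T a z <= t])).
    exact: Rintegral_natr_bool.
  by rewrite crossing_prob_le.
have e2 : \int[unif]_z X2 z = left_lim a t.
  transitivity (fine (unif [set z | crossing T a z < t])).
    exact: Rintegral_natr_bool.
  by rewrite crossing_prob_lt.
(* The indicators of [t < crossing] and [t = crossing] are expressed by [X1] and [X2], whose means
   are [a t] and the left limit of [a] at [t]. *)
transitivity (\int[unif]_z (f t + (h t - f t) * X1 z - h t * X2 z + X3 z)).
  apply: eq_Rintegral => z _; rewrite /X3 /X1 /X2.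
  by case: (ltgtP (crossing T a z) t) => _ /=; ring.
have ic : unif.-integrable setT (EFin \o cst (f t)).
  exact: finite_measure_integrable_cst.
rewrite RintegralD//; last first.
  by apply: integB; [apply: integD => //; exact: integZ|exact: integZ].
rewrite RintegralB//; [|by apply: integD => //; exact: integZ|exact: integZ].
rewrite RintegralD//; last exact: integZ.
have e0 : \int[unif]_z (f t) = f t.
  transitivity (f t * fine (unif setT)); first exact: Rintegral_cst.
  by rewrite probability_setT mulr1.
by rewrite !RintegralZl// e0 e1 e2 /X3 /jump; ring.
Qed.

End crossing_law.

(** * The payoff averaged over the opponent's device *)

Section average_payoff.
Context d (Om : measurableType d) (R : realType) (P : probability Om R).
Context (T : R) (T_gt0 : 0 < T).
Local Notation integ X := (P.-integrable setT (EFin \o X)).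
Local Notation unif := (uniform_prob (@ltr01 R)).
Context (D : Om -> \bar R) (D_int : P.-integrable setT D).
Implicit Types (G : set (set Om)) (f h g X : R -> Om -> R) (Z tau : Om -> R).

(* The payoff of a player stopping at [t] against the randomised time generated
   by [X], the opponent's randomisation device being integrated out. *)
Definition average_payoff f h g X t w : R :=
  \int[unif]_z (f t w * (t < crossing T (X ^~ w) z)%R%:R +
    h t w * (t == crossing T (X ^~ w) z)%:R +
    g (crossing T (X ^~ w) z) w * (crossing T (X ^~ w) z < t)%R%:R).

(** The payoff formula requires a finite bound on the path of [g]. Integrability of [D] gives one
    outside a null set that does not depend on [t], so a random time may be substituted for [t]
    afterwards. *)
Lemma average_payoffE f h g X : dominated_process T D g ->
  (forall w, generating_path T (X ^~ w)) ->
  {ae P, forall w, forall t, 0 <= t <= T -> average_payoff f h g X t w =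
    \int[stieltjes T (X ^~ w)]_(s in `[0, t[) g s w +
    f t w * (1 - X t w) + h t w * jump (X ^~ w) t}.
Proof.
move=> [_ cg gD] gX; have := integrable_ae measurableT D_int.
apply: filterS => w /(_ I) Dw t tT.
apply: (payoff_crossing T_gt0 (M := fine (D w)) (f ^~ w) (h ^~ w) (gX w) (cg w)) => //.
by move=> s sT; rewrite -lee_fin fineK// gD.
Qed.

Lemma payoff_average G Z X f h g tau : <<s G >> `<=` measurable ->
  measurable_fun setT Z ->
  (forall A B, <<s G >> A -> measurable B ->
    P (A `&` Z @^-1` B) = (P A * unif B)%E) ->
  dominated_process T D f -> dominated_process T D h -> dominated_process T D g ->
  (forall t, 0 <= t <= T -> [/\ measurable_wrt G (f t), measurable_wrt G (h t) &
    measurable_wrt G (g t)]) ->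
  (forall t, 0 <= t <= T -> measurable_wrt G (X t)) ->
  (forall w, generating_path T (X ^~ w)) ->
  measurable_wrt G tau -> (forall w, 0 <= tau w <= T) ->
  let c w := average_payoff f h g X (tau w) w in
  [/\ measurable_wrt G c, integ c & forall A, <<s G >> A ->
    \int[P]_(w in A) payoff f h g tau (generated_time T Z X) w =
    \int[P]_(w in A) c w].
Proof.
move=> G_sub mZ ZG Df Dh Dg mfhg mX gX mtau tauT c.
(* [uniform_prob] is a measure on [measurableTypeR R], whose display differs
   from that of [R] *)
pose mR := measurableTypeR R.
pose OG := (g_sigma_algebraType G * mR)%type.
pose lift (Y : R -> Om -> R) (t : R) (z : OG) := Y t z.1.
have mlift (Y : Om -> R) : measurable_wrt G Y -> measurable_fun setT (fun z : OG => Y z.1).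
  by move=> mY; exact: (measurableT_comp mY measurable_fst).
(* [Phi] is the payoff with a free variable in place of the device [Z]. *)
pose Phi := payoff (lift f) (lift h) (lift g) (fun z : OG => tau z.1)
  (fun z : OG => crossing T (lift X ^~ z) z.2).
have mPhi : measurable_fun setT Phi.
  apply: (measurable_payoff T_gt0).
  - by move=> t tT; have [? ? ?] := mfhg t tT; split; exact: mlift.
  - move=> z; case: Df Dh Dg => _ cf _ [_ ch _] [_ cg _].
    by split; [exact: cf|exact: ch|exact: cg].
  - exact: mlift.
  - apply: (measurable_crossing T_gt0) => [z|t tT|]; [exact: gX|apply: mlift; exact: mX|].
    exact: (@measurable_snd _ _ (g_sigma_algebraType G) mR).
  - by move=> z; exact: tauT.
  - by move=> z; exact: crossing_itv.
have msigma : measurable_fun setT (generated_time T Z X).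
  apply: (measurable_crossing T_gt0) => // t tT.
  exact: (measurable_sub_sigma G_sub (mX t tT)).
have iPhi : integ (fun w => Phi (w, Z w)).
  apply: (integrable_payoff T_gt0 D_int Df Dh Dg) => //.
    exact: (measurable_sub_sigma G_sub mtau).
  by move=> w; exact: crossing_itv.
have mZ' : measurable_fun setT (Z : Om -> mR) by exact: mZ.
have ZG' A B : <<s G >> A -> measurable B ->
    P (A `&` (Z : Om -> mR) @^-1` B) = (P A * (unif : probability mR R) B)%E.
  by move=> GA mB; exact: ZG.
split.
- exact: (measurable_partial_integral G_sub mZ' ZG' mPhi iPhi).
- exact: (integrable_partial_integral G_sub mZ' ZG' mPhi iPhi).
- by move=> A GA; exact: (Rintegral_partial_integral G_sub mZ' ZG' GA mPhi iPhi).
Qed.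

End average_payoff.

(** * Independence and optional sampling on the grid *)

Section independence_generation.
Context d (Om : measurableType d) (R : realType) (P : probability Om R).
Implicit Types (A B : set Om) (G : set (set Om)).

Lemma Rintegral_indep_defect A B : measurable A -> measurable B ->
  \int[P]_(w in A) (\1_B w - fine (P B)) = fine (P (A `&` B)) - fine (P A) * fine (P B).
Proof.
move=> mA mB; rewrite RintegralB//.
- rewrite Rintegral_cst// mulrC; congr (_ - _).
  by rewrite /Rintegral integral_indic// setIC.
- by apply: (@integrableS _ _ _ _ setT) => //; exact: integrable_indic.
- exact: finite_measure_integrable_cst.
Qed.

(** Independence becomes a vanishing integral of a centred indicator, so that the extension lemmas
    for integrals apply to it. *)
Lemma indepP A B : measurable A -> measurable B ->
  P (A `&` B) = (P A * P B)%E <-> \int[P]_(w in A) (\1_B w - fine (P B)) = 0.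
Proof.
move=> mA mB; rewrite Rintegral_indep_defect//.
have mAB : measurable (A `&` B) by exact: measurableI.
split=> [->|/eqP]; first by rewrite fineM ?fin_num_measure// subrr.
rewrite subr_eq0 => /eqP e.
by rewrite -[LHS]fineK ?fin_num_measure// e EFinM !fineK ?fin_num_measure.
Qed.

Let integrable_defect B : measurable B ->
  P.-integrable setT (EFin \o (fun w => \1_B w - fine (P B))).
Proof.
move=> mB; apply: integB; first exact: integrable_indic.
exact: finite_measure_integrable_cst.
Qed.

Lemma indep_dynkin G B : setI_closed G -> G `<=` measurable -> measurable B ->
  (forall A, G A -> P (A `&` B) = (P A * P B)%E) ->
  forall A, <<s G >> A -> P (A `&` B) = (P A * P B)%E.
Proof.
move=> GI mG mB GB A GA.
have mA : measurable A.
  suff : <<s G >> `<=` measurable by exact.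
  by apply: smallest_sub => //; exact: sigma_algebra_measurable.
apply/indepP => //; apply: (integral_zero_dynkin _ GI) GA => //.
- exact: integrable_defect.
- by apply/(indepP measurableT mB); rewrite setTI probability_setT mul1e.
- by move=> C GC; apply/indepP; [exact: mG|by []|exact: GB].
Qed.

Lemma indep_join G1 G2 B :
  G1 `<=` measurable -> G2 `<=` measurable -> measurable B ->
  setI_closed G1 -> setI_closed G2 -> G1 setT -> G2 setT ->
  (forall A C, G1 A -> G2 C -> P (A `&` C `&` B) = (P (A `&` C) * P B)%E) ->
  forall A, <<s G1 `|` G2 >> A -> P (A `&` B) = (P A * P B)%E.
Proof.
move=> mG1 mG2 mB G1I G2I G1T G2T GB A GA.
have mA : measurable A.
  suff : <<s G1 `|` G2 >> `<=` measurable by exact.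
  apply: smallest_sub => //; first exact: sigma_algebra_measurable.
  by move=> C [/mG1|/mG2].
apply/indepP => //; apply: (integral_zero_join _ mG1 mG2) GA => //.
- exact: integrable_defect.
- move=> C E G1C G2E; apply/indepP; [|by []|exact: GB].
  by apply: measurableI; [exact: mG1|exact: mG2].
Qed.

End independence_generation.

Section sampling.
Context d (Om : measurableType d) (R : realType) (P : probability Om R).
Local Notation integ X := (P.-integrable setT (EFin \o X)).
Implicit Types (G : set (set Om)) (X : Om -> R).

Lemma sub_g_sigma G1 G2 : G1 `<=` <<s G2 >> -> <<s G1 >> `<=` <<s G2 >>.
Proof. by move=> G12; apply: smallest_sub => //; exact: smallest_sigma_algebra. Qed.

Lemma measurable_wrt_sub G1 G2 X : G1 `<=` <<s G2 >> -> measurable_wrt G1 X ->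
  measurable_wrt G2 X.
Proof.
by move=> G12 mX mD B mB; apply: (sub_g_sigma G12); exact: mX.
Qed.

Lemma g_sigma_setI_closed G : setI_closed <<s G >>.
Proof.
move=> A B GA GB; exact: (@measurableI _ (g_sigma_algebraType G)).
Qed.

Lemma g_sigma_setT G : <<s G >> setT.
Proof. exact: (@measurableT _ (g_sigma_algebraType G)). Qed.

(** Over an intersection the integral is the probability of the [G2]-event times an integral over a
    [G1]-event, hence 0, and this extends to the join. Independence is asked of the larger [G]
    because [X] is measurable for [G] and not for [G1]. *)
Lemma Rintegral_zero_enlarge G G1 G2 X : <<s G >> `<=` measurable ->
  <<s G1 >> `<=` <<s G >> -> <<s G2 >> `<=` measurable ->
  (forall A C, <<s G >> A -> <<s G2 >> C -> P (A `&` C) = (P A * P C)%E) ->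
  measurable_wrt G X -> integ X ->
  (forall A, <<s G1 >> A -> \int[P]_(w in A) X w = 0) ->
  forall A, <<s G1 `|` G2 >> A -> \int[P]_(w in A) X w = 0.
Proof.
move=> G_sub G1G G2_sub GG2 mX iX X0 A GA.
apply: (@integral_zero_join _ _ _ P X <<s G1 >> <<s G2 >>) => //.
- by move=> B /G1G/G_sub.
- exact: g_sigma_setI_closed.
- exact: g_sigma_setI_closed.
- exact: g_sigma_setT.
- exact: g_sigma_setT.
- move=> B C GB GC; rewrite (Rintegral_indep_event G_sub (G1G _ GB) (G2_sub _ GC))//.
    by rewrite X0// mulr0.
  by move=> B' GB'; exact: GG2.
- move: A GA; apply: sub_g_sigma => A [GA|GA]; apply: sub_sigma_algebra.
    by left; exact: sub_sigma_algebra.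
  by right; exact: sub_sigma_algebra.
Qed.

Context (T : R) (T_gt0 : 0 < T).

(** Discrete optional sampling: the sampled process is [X 0] plus grid increments restricted to the
    events [grid T n k <= tau], each with a nonnegative integral over [E]. *)
Lemma next_grid_sampling (X : R -> Om -> R) (tau : Om -> R) (E : set Om) n :
  (forall t, 0 <= t <= T -> integ (X t)) ->
  measurable_fun setT tau -> (forall w, 0 <= tau w <= T) -> measurable E ->
  (forall k, (k < n.+1)%N ->
    \int[P]_(w in E `&` [set w | grid T n k <= tau w]) X (grid T n k) w <=
    \int[P]_(w in E `&` [set w | grid T n k <= tau w]) X (grid T n k.+1) w) ->
  integ (fun w => X (next_grid T n (tau w)) w) /\
  \int[P]_(w in E) X 0 w <= \int[P]_(w in E) X (next_grid T n (tau w)) w.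
Proof.
move=> iX mtau tauT mE XE.
pose A k := [set w | grid T n k <= tau w].
have mA k : measurable (A k).
  by rewrite -[X in measurable X]setTI; exact: measurable_fun_ler.
have iXk k : (k <= n.+1)%N -> integ (X (grid T n k)).
  by move=> kn; apply: iX; exact: grid_itv.
pose Y k w := (X (grid T n k.+1) w - X (grid T n k) w) * \1_(A k) w.
have iY k : (k < n.+1)%N -> integ (Y k).
  move=> kn; apply: integ_indic => //.
  by apply: integB; apply: iXk => //; exact: ltnW.
have iX0 : integ (X 0) by apply: iX; rewrite lexx ltW.
have XnE w : X (next_grid T n (tau w)) w = X 0 w + \sum_(k < n.+1) Y k w.
  rewrite (next_grid_telescope T_gt0 (X ^~ w))//; congr (_ + _).
  apply: eq_bigr => k _; rewrite /Y indicE; congr (_ * _).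
  have [wk|wk] := boolP (_ <= _); first by rewrite mem_set.
  by rewrite memNset//=; exact/negP.
have iS : integ (fun w => \sum_(k < n.+1) Y k w) by exact: integ_sum.
split.
  rewrite (_ : (fun w => _) = (fun w => X 0 w + \sum_(k < n.+1) Y k w)).
    exact: integD.
  exact/funext.
rewrite [leRHS]Rintegral_setE [leLHS]Rintegral_setE.
have -> : \int[P]_w (X (next_grid T n (tau w)) w * \1_E w) =
    \int[P]_w (X 0 w * \1_E w + \sum_(k < n.+1) Y k w * \1_E w).
  by apply: eq_Rintegral => w _; rewrite XnE mulrDl mulr_suml.
have iYE k : (k < n.+1)%N -> integ (fun w => Y k w * \1_E w).
  by move=> kn; apply: integ_indic => //; exact: iY.
have iSE : integ (fun w => \sum_(k < n.+1) Y k w * \1_E w).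
  exact: (integ_sum (X := fun k w => Y k w * \1_E w)).
rewrite RintegralD//; last exact: integ_indic.
rewrite lerDl (Rintegral_sum iYE); apply: sumr_ge0 => k _.
have -> : \int[P]_w (Y k w * \1_E w) =
    \int[P]_w (X (grid T n k.+1) w * \1_(E `&` A k) w - X (grid T n k) w * \1_(E `&` A k) w).
  by apply: eq_Rintegral => w _; rewrite !indicI /Y /=; ring.
rewrite RintegralB// ?subr_ge0 -?Rintegral_setE ?XE//.
- by apply: integ_indic; [exact: measurableI|exact: iXk].
- by apply: integ_indic; [exact: measurableI|apply: iXk; exact: ltnW].
Qed.

(** * Filtrations enlarged by [J] and by a randomisation device *)

Section filtrations.
Context (F1 F2 : R -> set (set Om)) (J : Om -> bool) (Z : Om -> R).
Hypothesis mZ : measurable_fun setT Z.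
Hypothesis F2_sub : forall t, 0 <= t <= T -> <<s F2 t >> `<=` measurable.
Hypothesis F2_id : forall t, 0 <= t <= T -> <<s F2 t >> `<=` F2 t.
Hypothesis F2_mono : forall s t, 0 <= s -> s <= t -> t <= T -> F2 s `<=` <<s F2 t >>.
Hypothesis F1_sub : forall t, 0 <= t <= T -> <<s F1 t >> `<=` measurable.
Hypothesis F1_mono : forall s t, 0 <= s -> s <= t -> t <= T -> F1 s `<=` <<s F1 t >>.
Hypothesis F1E : forall t, 0 <= t <= T -> F1 t `<=` <<s F2 t `|` g_sigma_algebra_preimage J >>.
Hypothesis F12 : forall t, 0 <= t <= T -> F2 t `<=` <<s F1 t >>.
Hypothesis mJ : measurable_fun setT J.
Hypothesis J_indep : forall A B, <<s F2 T >> A -> <<s g_sigma_algebra_preimage J >> B ->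
  P (A `&` B) = (P A * P B)%E.
Hypothesis Z_indep : forall A B, <<s F1 T >> A -> <<s g_sigma_algebra_preimage Z >> B ->
  P (A `&` B) = (P A * P B)%E.

Lemma g_sigma_preimage_sub d' (S : measurableType d') (Y : Om -> S) :
  measurable_fun setT Y -> <<s g_sigma_algebra_preimage Y >> `<=` measurable.
Proof.
move=> mY; apply: smallest_sub; first exact: sigma_algebra_measurable.
by move=> _ [B mB <-]; exact: mY.
Qed.

Let T0T : 0 <= T <= T. Proof. by rewrite lexx ltW. Qed.

Lemma submartingale_enlarged M s t A : submartingale P T F2 M ->
  0 <= s -> s <= t -> t <= T ->
  <<s F1 s `|` g_sigma_algebra_preimage Z >> A ->
  \int[P]_(w in A) M s w <= \int[P]_(w in A) M t w.
Proof.
move=> [adM iM subM] s0 st tT FA.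
have t0T : 0 <= t <= T by rewrite (le_trans s0).
have s0T : 0 <= s <= T by rewrite s0 (le_trans st).
have sT := le_trans st tT.
have [Y [mY iY YE] MY] := subM s t s0 st tT.
have mA : measurable A.
  suff : <<s F1 s `|` g_sigma_algebra_preimage Z >> `<=` measurable by exact.
  apply: smallest_sub; first exact: sigma_algebra_measurable.
  move=> B [FB|FB]; first by apply: (F1_sub s0T); exact: sub_sigma_algebra.
  by apply: (g_sigma_preimage_sub mZ); exact: sub_sigma_algebra.
have iMt := iM t t0T; have iMs := iM s s0T.
pose X w := M t w - Y w.
have iX : integ X by exact: integB.
have mX2 : measurable_wrt (F2 T) X.
  apply: measurable_funB.
  - by apply: measurable_wrt_sub (adM t t0T); apply: F2_mono => //; rewrite (le_trans s0).
  - by apply: measurable_wrt_sub mY; exact: F2_mono.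
have mX1 : measurable_wrt (F1 T) X by apply: measurable_wrt_sub mX2; exact: F12.
have iS B Y' : measurable B -> integ Y' -> P.-integrable B (EFin \o Y').
  by move=> mB iY'; exact: integrableS iY'.
have X1 B : <<s F1 s >> B -> \int[P]_(w in B) X w = 0.
  move=> FB; apply: (@Rintegral_zero_enlarge (F2 T) (F2 s) (g_sigma_algebra_preimage J) X) => //.
  - exact: F2_sub.
  - by apply: sub_g_sigma; exact: F2_mono.
  - exact: g_sigma_preimage_sub.
  - move=> C FC; have mC := F2_sub s0T FC.
    rewrite RintegralB//; [|exact: iS|exact: iS].
    by rewrite YE ?subrr//; exact: F2_id.
  - by apply: (sub_g_sigma (F1E s0T)).
have X0 : \int[P]_(w in A) X w = 0.
  apply: (@Rintegral_zero_enlarge (F1 T) (F1 s) (g_sigma_algebra_preimage Z) X) => //.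
  - exact: F1_sub.
  - by apply: sub_g_sigma; exact: F1_mono.
  - exact: g_sigma_preimage_sub.
have -> : \int[P]_(w in A) M t w = \int[P]_(w in A) Y w.
  by apply/eqP; rewrite -subr_eq0 -RintegralB//; [exact/eqP|exact: iS|exact: iS].
rewrite [leLHS]Rintegral_setE [leRHS]Rintegral_setE; apply: ae_le_Rintegral.
- exact: integ_indic.
- exact: integ_indic.
- by apply: filterS MY => w MYw; rewrite ler_wpM2r// indicE; case: (_ \in _).
Qed.

Lemma g_sigmaU_l G1 G2 : <<s G1 >> `<=` <<s G1 `|` G2 >>.
Proof. by apply: sub_g_sigma => A GA; apply: sub_sigma_algebra; left. Qed.

Lemma g_sigmaU_r G1 G2 : G2 `<=` <<s G1 `|` G2 >>.
Proof. by move=> A GA; apply: sub_sigma_algebra; right. Qed.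

(** The complement is decided by the device and by countably many values of [rho] at times strictly
    before [t], so no information beyond [t] enters. *)
Lemma generated_time_past rho t : generating_processes T F1 rho -> 0 <= t <= T ->
  <<s F1 t `|` g_sigma_algebra_preimage Z >> [set w | t <= generated_time T Z rho w].
Proof.
move=> [adrho grho] /andP[t0 tT].
pose S := g_sigma_algebraType (F1 t `|` g_sigma_algebra_preimage Z).
have mZS : measurable_fun setT (Z : S -> R).
  by move=> _ B mB; apply: g_sigmaU_r; exists B.
have -> : [set w | t <= generated_time T Z rho w] =
    ~` [set w | crossing T (rho ^~ w) (Z w) < t].
  by apply/seteqP; split=> w /=; rewrite leNgt => /negP.
apply: (@measurableC _ S).
move: t0; rewrite le_eqVlt => /predU1P[t0|t0].
  rewrite [X in measurable X](_ : _ = set0)//; apply/seteqP; split=> // w /=.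
  by rewrite -t0 ltNge; have /andP[->] := crossing_itv T_gt0 (rho ^~ w) (Z w).
rewrite (crossing_ltE T_gt0 _ grho) ?t0//; apply: (@measurableU _ S).
  by rewrite -[X in measurable X]setTI; exact: (@measurable_fun_ler _ S).
rewrite bigcup_mkcond; apply: (@bigcupT_measurable_rat _ S) => q.
case: ifPn => // /set_mem[q0 qt].
have qT : ratr q <= T by rewrite ltW// (lt_le_trans qt).
rewrite -[X in measurable X]setTI; apply: (@measurable_fun_ltr _ S) => //.
apply: measurable_wrt_sub (adrho (ratr q) _); last by rewrite q0.
by move=> B FB; apply: g_sigmaU_l; apply: (@F1_mono (ratr q)) => //; exact: ltW.
Qed.

(** The events [grid T n k <= tau], cut with the initial event [E], lie in the enlarged past at the
    grid time, where the increments of [M] keep their sign. *)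
Lemma optional_sampling M rho n E : submartingale P T F2 M ->
  generating_processes T F1 rho -> <<s F1 0 `|` g_sigma_algebra_preimage Z >> E ->
  let tau := generated_time T Z rho in
  integ (fun w => M (next_grid T n (tau w)) w) /\
  \int[P]_(w in E) M 0 w <= \int[P]_(w in E) M (next_grid T n (tau w)) w.
Proof.
move=> subM grho FE tau; have [adrho prho] := grho.
have [_ iM _] := subM.
apply: next_grid_sampling => //.
- apply: (measurable_crossing T_gt0) => // t tT.
  exact: (measurable_sub_sigma (F1_sub tT) (adrho t tT)).
- by move=> w; exact: crossing_itv.
- suff : <<s F1 0 `|` g_sigma_algebra_preimage Z >> `<=` measurable by exact.
  apply: smallest_sub; first exact: sigma_algebra_measurable.
  move=> B [FB|FB]; last by apply: (g_sigma_preimage_sub mZ); exact: sub_sigma_algebra.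
  by apply: (@F1_sub 0); [rewrite lexx ltW|exact: sub_sigma_algebra].
- move=> k kn; have /andP[k0 kT] := grid_itv T_gt0 (ltnW kn).
  have /andP[k0' kT'] := grid_itv T_gt0 kn.
  apply: submartingale_enlarged => //; first exact: le_grid.
  apply: g_sigma_setI_closed; last by apply: generated_time_past => //; rewrite k0.
  move: E FE; apply: sub_g_sigma => B [FB|FB]; last exact: g_sigmaU_r.
  by apply: g_sigmaU_l; exact: (@F1_mono 0).
Qed.

Implicit Types (tau : Om -> R) (rho : R -> Om -> R) (Y : bool -> R -> Om -> R).
(** [Z'] is the device of the fixed opponent and [Z] that of the deviating player; each of the two
    players takes either role later. *)
Context (Z' : Om -> R) (mZ' : measurable_fun setT Z').
Local Notation unif := (uniform_prob (@ltr01 R)).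
Hypothesis Z'_indep : forall A B, <<s F1 T `|` g_sigma_algebra_preimage Z >> A ->
  measurable B -> P (A `&` Z' @^-1` B) = (P A * unif B)%E.
Hypothesis J_F1 : forall t, 0 <= t <= T -> g_sigma_algebra_preimage J `<=` <<s F1 t >>.

Local Notation event i := [set w | J w = i].
Local Notation prob i := (fine (P (event i))).

Let event_preimage i : g_sigma_algebra_preimage J (event i).
Proof. by exists [set i] => //; rewrite setTI. Qed.

Let measurable_event i : measurable (event i).
Proof.
by apply: (g_sigma_preimage_sub mJ); apply: sub_sigma_algebra; exact: event_preimage.
Qed.

(** [Z] is independent of [F2 T] and [J] jointly, and [J] of [F2 T]; hence triple intersections
    factor, and the pi-system argument gives the join. *)
Let J_indepZ A i : <<s F2 T `|` g_sigma_algebra_preimage Z >> A ->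
  P (A `&` event i) = (P A * P (event i))%E.
Proof.
have mF2 : <<s F2 T >> `<=` measurable by exact: (F2_sub T0T).
have mGZ := g_sigma_preimage_sub mZ.
have F21 : <<s F2 T >> `<=` <<s F1 T >> by apply: sub_g_sigma; exact: (F12 T0T).
have FJ : <<s F1 T >> (event i) by apply: (J_F1 T0T); exact: event_preimage.
move=> FA; apply: (@indep_join _ _ _ P <<s F2 T >> <<s g_sigma_algebra_preimage Z >>) => //.
- exact: g_sigma_setI_closed.
- exact: g_sigma_setI_closed.
- exact: g_sigma_setT.
- exact: g_sigma_setT.
- move=> B C FB GC; rewrite setIAC Z_indep//; last first.
    by apply: g_sigma_setI_closed => //; exact: F21.
  rewrite (Z_indep (F21 _ FB) GC).
  rewrite J_indep//; last by apply: sub_sigma_algebra; exact: event_preimage.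
  by rewrite muleAC.
- move: A FA; apply: sub_g_sigma => A [GA|GA]; apply: sub_sigma_algebra.
    by left; exact: sub_sigma_algebra.
  by right; exact: sub_sigma_algebra.
Qed.

(** The counterpart of [mixture] for [J] defined on the whole space rather than on the second
    factor. *)
Definition mix (Y : bool -> R -> Om -> R) t w := if J w then Y true t w else Y false t w.

Context (D : Om -> \bar R) (D_int : P.-integrable setT D).
Context (f h g : bool -> R -> Om -> R).
Hypothesis fD : forall i, dominated_process T D (f i).
Hypothesis hD : forall i, dominated_process T D (h i).
Hypothesis gD : forall i, dominated_process T D (g i).
Hypothesis f_ad : forall i, adapted T F2 (f i).
Hypothesis h_ad : forall i, adapted T F2 (h i).
Hypothesis g_ad : forall i, adapted T F2 (g i).
Hypothesis gh : forall i, {ae P, forall w, forall t, 0 <= t <= T -> g i t w <= h i t w}.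

Lemma dominated_mix Y : (forall i, dominated_process T D (Y i)) ->
  dominated_process T D (mix Y).
Proof.
move=> YD; split.
- move=> t tT; rewrite (_ : mix Y t = fun w => if J w then Y true t w else Y false t w)//.
  by apply: measurable_fun_ifT => //; [have [+ _ _] := YD true|have [+ _ _] := YD false];
    exact.
- move=> w; rewrite (_ : mix Y ^~ w = Y (J w) ^~ w).
    by have [_ + _] := YD (J w); exact.
  by apply/funext => t; rewrite /mix; case: (J w).
- move=> t w tT; rewrite (_ : mix Y t w = Y (J w) t w); last by rewrite /mix; case: (J w).
  by have [_ _ +] := YD (J w); exact.
Qed.

Let adaptedF1 (Y : R -> Om -> R) t : adapted T F2 Y -> 0 <= t <= T -> measurable_wrt (F1 t) (Y t).
Proof. by move=> aY tT; apply: measurable_wrt_sub (aY t tT); exact: F12. Qed.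

Let adapted_T (F : R -> set (set Om)) (Y : R -> Om -> R) t :
  (forall s t, 0 <= s -> s <= t -> t <= T -> F s `<=` <<s F t >>) ->
  adapted T F Y -> 0 <= t <= T -> measurable_wrt (F T) (Y t).
Proof.
move=> mF aY /[dup] tT /andP[t0 t1]; apply: measurable_wrt_sub (aY t tT).
exact: mF.
Qed.

(** * Payoff bounds against a fixed opponent *)

Section against_strategy.
(** The opponent plays [mix X]; a constant family describes an opponent who does not observe [J]. *)
Context (X : bool -> R -> Om -> R) (genX : forall i, generating_processes T F2 (X i)).
Local Notation sigma := (generated_time T Z' (mix X)).
Local Notation sigma_ i := (generated_time T Z' (X i)).
Local Notation c i := (average_payoff T (f i) (h i) (g i) (X i)).

Let measurable_generated_time (F : R -> set (set Om)) rho (Y : Om -> R) :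
  (forall t, 0 <= t <= T -> <<s F t >> `<=` measurable) -> measurable_fun setT Y ->
  generating_processes T F rho -> measurable_fun setT (generated_time T Y rho).
Proof.
move=> mF mY [adrho prho]; apply: (measurable_crossing T_gt0) => // t tT.
exact: (measurable_sub_sigma (mF t tT) (adrho t tT)).
Qed.

Let generated_time_itv (Y : Om -> R) (rho : R -> Om -> R) w : 0 <= generated_time T Y rho w <= T.
Proof. exact: crossing_itv. Qed.

Let sigmaE i w : J w = i -> sigma w = sigma_ i w.
Proof.
by move=> Jw; rewrite /generated_time /mix Jw; case: i {Jw}.
Qed.

Let msigma : measurable_fun setT sigma.
Proof.
rewrite (_ : sigma = fun w => if J w then sigma_ true w else sigma_ false w).
  by apply: measurable_fun_ifT => //; exact: (measurable_generated_time F2_sub mZ' (genX _)).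
by apply/funext => w; case: ifPn => Jw; apply: sigmaE => //; exact/negbTE.
Qed.

(** On [J = i] the mixed payoffs and strategy coincide with their components of index [i], which are
    adapted to the small filtration. *)
Lemma payoff_mix_split tau : measurable_fun setT tau -> (forall w, 0 <= tau w <= T) ->
  \int[P]_w payoff (mix f) (mix h) (mix g) tau sigma w =
  \int[P]_(w in event true) payoff (f true) (h true) (g true) tau (sigma_ true) w +
  \int[P]_(w in event false) payoff (f false) (h false) (g false) tau (sigma_ false) w.
Proof.
move=> mtau tauT.
have eJ i : \int[P]_(w in event i) payoff (f i) (h i) (g i) tau (sigma_ i) w =
    \int[P]_(w in event i) payoff (mix f) (mix h) (mix g) tau sigma w.
  apply: eq_Rintegral => w; rewrite inE/= => Jw.
  by rewrite /payoff (sigmaE Jw) /mix Jw; case: i {Jw}.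
rewrite !eJ -Rintegral_setU//.
- congr (Rintegral _ _ _); apply/seteqP; split => // w _ /=.
  by case: (J w); [left|right].
- apply: (@integrableS _ _ _ _ setT) => //; first exact: measurableU.
  by apply: (integrable_payoff T_gt0 D_int) => //; exact: dominated_mix.
- by apply/disj_setPS => w /= [->].
Qed.

Let next_wrt G tau n : measurable_wrt G tau -> (forall w, 0 <= tau w <= T) ->
  measurable_wrt G (next_grid T n \o tau).
Proof.
move=> mtau tauT.
exact: (@measurable_next_grid_sample _ _ T_gt0 _ (g_sigma_algebraType G) tau (fun t _ => t) n).
Qed.

Let tau_wrt (F : R -> set (set Om)) rho :
  (forall s t, 0 <= s -> s <= t -> t <= T -> F s `<=` <<s F t >>) ->
  generating_processes T F rho ->
  measurable_wrt (F T `|` g_sigma_algebra_preimage Z) (generated_time T Z rho).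
Proof.
move=> mF [adrho prho].
apply: (@measurable_crossing _ _ T_gt0 _ (g_sigma_algebraType (F T `|` g_sigma_algebra_preimage Z)) rho Z) => //.
  move=> t tT; apply: measurable_wrt_sub (adapted_T mF adrho tT).
  by move=> B FB; apply: g_sigmaU_l; exact: sub_sigma_algebra.
by move=> _ B mB; apply: g_sigmaU_r; exists B.
Qed.

Let F1Z_sub : <<s F1 T `|` g_sigma_algebra_preimage Z >> `<=` measurable.
Proof.
apply: smallest_sub; first exact: sigma_algebra_measurable.
move=> B [FB|FB]; first by apply: (F1_sub T0T); exact: sub_sigma_algebra.
by apply: (g_sigma_preimage_sub mZ); exact: sub_sigma_algebra.
Qed.

Let F21Z : F2 T `|` g_sigma_algebra_preimage Z `<=`
  <<s F1 T `|` g_sigma_algebra_preimage Z >>.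
Proof. by move=> B [FB|FB]; [apply: g_sigmaU_l; exact: (F12 T0T)|exact: g_sigmaU_r]. Qed.

Let average i tau : measurable_wrt (F1 T `|` g_sigma_algebra_preimage Z) tau ->
  (forall w, 0 <= tau w <= T) ->
  integ (fun w => c i (tau w) w) /\
  \int[P]_(w in event i) payoff (f i) (h i) (g i) tau (sigma_ i) w =
  \int[P]_(w in event i) c i (tau w) w.
Proof.
move=> mtau tauT.
have wrt (Y : R -> Om -> R) t : adapted T F2 Y -> 0 <= t <= T ->
    measurable_wrt (F1 T `|` g_sigma_algebra_preimage Z) (Y t).
  move=> aY tT; apply: measurable_wrt_sub (adapted_T F2_mono aY tT).
  by move=> B FB; apply: g_sigmaU_l; exact: F12.
have [adX pX] := genX i.
have [||_ ic ec] := payoff_average T_gt0 D_int F1Z_sub mZ' Z'_indep (fD i) (hD i) (gD i) _ _ pX mtau tauT.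
- by move=> t tT; split; exact: wrt.
- by move=> t tT; exact: wrt.
split=> //; apply: ec; apply: g_sigmaU_l; apply: (J_F1 T0T); exact: event_preimage.
Qed.

(** When the deviating player does not observe [J], the averaged payoff is measurable without [J] as
    well, so that [J] can be factored out of its integral. *)
Let average_measurable i tau : measurable_wrt (F2 T `|` g_sigma_algebra_preimage Z) tau ->
  (forall w, 0 <= tau w <= T) ->
  measurable_wrt (F2 T `|` g_sigma_algebra_preimage Z) (fun w => c i (tau w) w).
Proof.
move=> mtau tauT.
have wrt (Y : R -> Om -> R) t : adapted T F2 Y -> 0 <= t <= T ->
    measurable_wrt (F2 T `|` g_sigma_algebra_preimage Z) (Y t).
  move=> aY tT; apply: measurable_wrt_sub (adapted_T F2_mono aY tT).
  by move=> B FB; apply: g_sigmaU_l; exact: sub_sigma_algebra.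
have [adX pX] := genX i.
have ind A B : <<s F2 T `|` g_sigma_algebra_preimage Z >> A -> measurable B ->
    P (A `&` Z' @^-1` B) = (P A * unif B)%E.
  by move=> FA mB; apply: Z'_indep => //; exact: (sub_g_sigma F21Z).
have [||+ _ _] := payoff_average T_gt0 D_int (subset_trans (sub_g_sigma F21Z) F1Z_sub)
  mZ' ind (fD i) (hD i) (gD i) _ _ pX mtau tauT => //.
- by move=> t tT; split; exact: wrt.
- by move=> t tT; exact: wrt.
Qed.

(** The reduction common to both players: pass to grid times, split along [J], average out the
    opponent's device. *)
Let payoff_next_grid_bound rho (v : R) :
  generating_processes T F1 rho ->
  (forall n, v <= \int[P]_(w in event true)
        c true (next_grid T n (generated_time T Z rho w)) w +
      \int[P]_(w in event false)
        c false (next_grid T n (generated_time T Z rho w)) w) ->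
  v <= \int[P]_w payoff (mix f) (mix h) (mix g) (generated_time T Z rho) sigma w.
Proof.
move=> grho vn; have mtau := measurable_generated_time F1_sub mZ grho.
have wtau := tau_wrt F1_mono grho.
apply: (payoff_next_grid_le T_gt0 D_int) => //; [exact: dominated_mix..|idtac|].
  apply: filterS2 (gh true) (gh false) => w ght ghf t tT.
  by rewrite /mix; case: (J w); [exact: ght|exact: ghf].
move=> n; have wn := next_wrt n wtau (generated_time_itv Z rho).
have nT w : 0 <= (next_grid T n \o generated_time T Z rho) w <= T.
  by apply: next_grid_itv => //; exact: crossing_itv.
rewrite payoff_mix_split//; last exact: (measurable_sub_sigma F1Z_sub wn).
rewrite (average true wn nT).2 (average false wn nT).2; exact: vn.
Qed.

(** The deviating player knows [J] from time 0 on, so [M i] can be sampled on the event [J = i]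
    alone, where the averaged payoff dominates it. *)
Lemma informed_lower_bound (M : bool -> R -> Om -> R) rho :
  (forall i, submartingale P T F2 (M i)) ->
  (forall i, {ae P, forall w, forall t, 0 <= t <= T -> M i t w <=
    \int[stieltjes T (X i ^~ w)]_(s in `[0, t[) g i s w +
    f i t w * (1 - X i t w) + h i t w * jump (X i ^~ w) t}) ->
  generating_processes T F1 rho ->
  prob true * (\int[P]_w M true 0 w) + prob false * (\int[P]_w M false 0 w) <=
  \int[P]_w payoff (mix f) (mix h) (mix g) (generated_time T Z rho) sigma w.
Proof.
move=> subM Mc grho; apply: payoff_next_grid_bound => // n.
have wtau := tau_wrt F1_mono grho.
have wn := next_wrt n wtau (generated_time_itv Z rho).
have nT w : 0 <= (next_grid T n \o generated_time T Z rho) w <= T.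
  by apply: next_grid_itv => //; exact: crossing_itv.
suff bound i : prob i * (\int[P]_w M i 0 w) <=
    \int[P]_(w in event i) c i (next_grid T n (generated_time T Z rho w)) w.
  by rewrite lerD.
have [_ iM _] := subM i.
have O0T : 0 <= (0 : R) <= T by rewrite lexx ltW.
(* [M i 0] is measurable for the small filtration, hence independent of [J]. *)
have -> : prob i * (\int[P]_w M i 0 w) = \int[P]_(w in event i) M i 0 w.
  have ind B : <<s F2 T >> B -> P (B `&` event i) = (P B * P (event i))%E.
    by move=> FB; apply: J_indep => //; apply: sub_sigma_algebra; exact: event_preimage.
  have [adM _ _] := subM i; have mM := adapted_T F2_mono adM O0T.
  have := Rintegral_indep_event (F2_sub T0T) (@g_sigma_setT _) (measurable_event i)
    ind mM (iM 0 O0T).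
  by rewrite setTI.
have FE : <<s F1 0 `|` g_sigma_algebra_preimage Z >> (event i).
  by apply: g_sigmaU_l; apply: (J_F1 O0T); exact: event_preimage.
have [iMn Mn] := optional_sampling n (subM i) grho FE.
apply: (le_trans Mn); rewrite [leLHS]Rintegral_setE [leRHS]Rintegral_setE.
have [ic _] := average i wn nT.
apply: ae_le_Rintegral; [exact: integ_indic|exact: integ_indic|].
have := average_payoffE T_gt0 D_int (f i) (h i) (gD i) (genX i).2.
apply: filterS2 (Mc i) => w Mw cw; rewrite ler_wpM2r//.
by rewrite cw ?Mw//; exact: nT.
Qed.

(** Both averaged payoffs are evaluated at one stopping time that carries no information on [J]:
    their integrals over [J = i] acquire the weights [prob i], and a single process [N] is sampled
    on the whole space. *)
Lemma uninformed_lower_bound (N : R -> Om -> R) rho :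
  submartingale P T F2 N ->
  {ae P, forall w, forall t, 0 <= t <= T -> N t w <=
    prob true * (\int[stieltjes T (X true ^~ w)]_(s in `[0, t[) g true s w +
      f true t w * (1 - X true t w) + h true t w * jump (X true ^~ w) t) +
    prob false * (\int[stieltjes T (X false ^~ w)]_(s in `[0, t[) g false s w +
      f false t w * (1 - X false t w) + h false t w * jump (X false ^~ w) t)} ->
  generating_processes T F2 rho ->
  \int[P]_w N 0 w <=
  \int[P]_w payoff (mix f) (mix h) (mix g) (generated_time T Z rho) sigma w.
Proof.
move=> subN Nc grho2.
have grho : generating_processes T F1 rho.
  by case: grho2 => adrho prho; split => // t tT; exact: adaptedF1.
apply: payoff_next_grid_bound => // n.
have wtau := tau_wrt F2_mono grho2.
have wn2 := next_wrt n wtau (generated_time_itv Z rho).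
have wn := measurable_wrt_sub F21Z wn2.
have nT w : 0 <= (next_grid T n \o generated_time T Z rho) w <= T.
  by apply: next_grid_itv => //; exact: crossing_itv.
have [iNn] := optional_sampling n subN grho (@g_sigma_setT _).
move=> /le_trans; apply.
have mF2Z := subset_trans (sub_g_sigma F21Z) F1Z_sub.
have indep_event i : \int[P]_(w in event i) c i (next_grid T n (generated_time T Z rho w)) w =
    prob i * \int[P]_w c i (next_grid T n (generated_time T Z rho w)) w.
  have ind B : <<s F2 T `|` g_sigma_algebra_preimage Z >> B ->
      P (B `&` event i) = (P B * P (event i))%E by exact: J_indepZ.
  have := Rintegral_indep_event mF2Z (@g_sigma_setT _) (measurable_event i)
    ind (average_measurable i wn2 nT) (average i wn nT).1.
  by rewrite setTI.
have it := (average true wn nT).1; have if_ := (average false wn nT).1.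
rewrite !indep_event -!RintegralZl// -RintegralD//; [|exact: integZ|exact: integZ].
apply: ae_le_Rintegral => //; first by apply: integD; exact: integZ.
have := average_payoffE T_gt0 D_int (f true) (h true) (gD true) (genX true).2.
have := average_payoffE T_gt0 D_int (f false) (h false) (gD false) (genX false).2.
apply: filterS3 Nc => w Nw cf ct.
by rewrite ct ?cf ?Nw//; exact: nT.
Qed.

End against_strategy.

End filtrations.
End sampling.

(** * The completed product space *)

Section completion_measurability.
Context d (S : measurableType d) (R : realType) (Q : probability S R).

Lemma completion_measurable (A : set S) : measurable A ->
  measurable (A : set (completion_type Q)).
Proof. by move=> mA; exists A => //; exists set0; [exact: negligible_set0|rewrite setU0]. Qed.

(** A null set of the completion is covered by a null set of the original space: the measurable part
    [B] of its cover has measure 0 and the rest lies in [K]. *)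
Lemma completion_negligible_measurable (N : set (completion_type Q)) :
  (completion Q).-negligible N -> measurable N.
Proof.
move=> [A [mA A0 NA]]; have [B mB [M [K [mK K0 MK]] BMA]] := mA.
exists set0 => //; exists N; last by rewrite set0U.
exists (B `|` K); split; first exact: measurableU.
  apply: null_set_setU => //.
  apply/eqP; rewrite eq_le measure_ge0 andbT -A0.
  apply: (@le_trans _ _ (completion Q B)); first by rewrite completionE.
  apply: (le_measure (completion Q)); rewrite ?inE//; first exact: completion_measurable.
  by rewrite -BMA; exact: subsetUl.
apply: (subset_trans NA); rewrite -BMA.
by move=> w [Bw|/MK Kw]; [left|right].
Qed.

End completion_measurability.

Section product_filtrations.
Context (R : realType) (T : R) (T_gt0 : 0 < T) (d0 d1 : measure_display)
  (Om0 : measurableType d0) (Om1 : measurableType d1)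
  (P0 : probability Om0 R) (P1 : probability Om1 R).
Local Notation Om := (completed_product P0 P1).
Local Notation P := (completed_product_prob P0 P1).
Context (H : R -> set (set Om0)) (H_filtration : filtration T H).
Context (J : {mfun Om1 >-> bool}).
Local Notation F2 := (uninformed_filtration P0 P1 H).
Local Notation F1 := (informed_filtration P0 P1 H J).
Local Notation J' := (fun w : Om => J w.2).
Local Notation cyl := (@cylinders _ _ _ _ _ P0 P1 H).
Implicit Types t s : R.

Lemma measurable_J : measurable_fun setT J'.
Proof.
move=> _ B mB; rewrite setTI; apply: completion_measurable.
rewrite -[X in measurable X]setTI.
by apply: (measurableT_comp (f := J) (g := snd)) => //; exact: measurable_snd.
Qed.

Lemma cylinders_measurable t : 0 <= t <= T -> cyl t `<=` measurable.
Proof.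
move=> tT _ [A HA [B BE <-]]; apply: completion_measurable.
have [/(_ t tT)[_ mH] _] := H_filtration.
apply: measurableX; first exact: mH.
by case: BE => ->.
Qed.

Lemma cylinders_setI t : 0 <= t <= T -> setI_closed (cyl t).
Proof.
move=> tT _ _ [A HA [B BE <-]] [A' HA' [B' BE' <-]].
have [/(_ t tT)[sH _] _] := H_filtration.
exists (A `&` A').
  rewrite -(sigma_algebra_id sH); apply: g_sigma_setI_closed; exact: sub_sigma_algebra.
exists (B `&` B'); last by rewrite setXI.
by case: BE => ->; case: BE' => ->; rewrite ?setIT ?setI0 ?set0I; [left|right..].
Qed.

Lemma uninformed_sub t : 0 <= t <= T -> <<s F2 t >> `<=` measurable.
Proof.
move=> tT; rewrite sigma_algebra_id; last exact: smallest_sigma_algebra.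
apply: smallest_sub; first exact: sigma_algebra_measurable.
by move=> A [|]; [exact: cylinders_measurable|exact: completion_negligible_measurable].
Qed.

Lemma uninformed_mono s t : 0 <= s -> s <= t -> t <= T -> F2 s `<=` <<s F2 t >>.
Proof.
move=> s0 st tT; apply: subset_trans; last exact: sub_sigma_algebra.
apply: sub_g_sigma => A [[B HB [C CE <-]]|NA]; apply: sub_sigma_algebra; last by right.
left; exists B; last by exists C.
by have [_ /(_ s t s0 st tT)] := H_filtration; exact.
Qed.

Lemma informed_sub t : 0 <= t <= T -> <<s F1 t >> `<=` measurable.
Proof.
move=> tT; rewrite sigma_algebra_id; last exact: smallest_sigma_algebra.
apply: smallest_sub; first exact: sigma_algebra_measurable.
move=> A [FA|JA]; first by apply: (uninformed_sub tT); exact: sub_sigma_algebra.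
by apply: (g_sigma_preimage_sub measurable_J); exact: sub_sigma_algebra.
Qed.

Lemma informed_mono s t : 0 <= s -> s <= t -> t <= T -> F1 s `<=` <<s F1 t >>.
Proof.
move=> s0 st tT; apply: subset_trans; last exact: sub_sigma_algebra.
apply: sub_g_sigma => A [FA|JA]; last exact: g_sigmaU_r.
by apply: g_sigmaU_l; exact: (uninformed_mono s0).
Qed.

Lemma uninformed_informed t : F2 t `<=` <<s F1 t >>.
Proof. by move=> A FA; do 2?apply: sub_sigma_algebra; left. Qed.

Lemma completed_productE (A : set Om0) (B : set Om1) :
  measurable A -> measurable B -> P (A `*` B) = (P0 A * P1 B)%E.
Proof.
move=> mA mB; transitivity ((P0 \x P1)%E (A `*` B)); last exact: product_measure1E.
by apply: completionE; exact: measurableX.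
Qed.

Lemma prob_J i : P [set w | J' w = i] = P1 [set w | J w = i].
Proof.
have -> : [set w | J' w = i] = setT `*` [set w | J w = i].
  by apply/seteqP; split => [w|w []]//=.
have mi : measurable [set w | J w = i] by have := @measurable_funPTI _ _ _ _ J [set i]; apply.
by rewrite completed_productE// probability_setT mul1e.
Qed.

(** Cylinders together with null sets are stable under intersection and generate [F2 T]. For a
    cylinder the claim is the product formula on rectangles; for a null set both sides vanish. *)
Lemma J_indep_uninformed A B : <<s F2 T >> A ->
  <<s g_sigma_algebra_preimage J' >> B -> P (A `&` B) = (P A * P B)%E.
Proof.
have T0T : 0 <= T <= T by rewrite lexx ltW.
rewrite sigma_algebra_id; last exact: smallest_sigma_algebra.
move=> FA; have -> : <<s g_sigma_algebra_preimage J' >> = g_sigma_algebra_preimage J'.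
  by apply: sigma_algebra_id; exact: sigma_algebra_preimage.
move=> [C mC <-]; move: A FA.
have mB : measurable (setT `&` J' @^-1` C) by exact: measurable_J.
have mJC : measurable (J @^-1` C) by exact: measurable_funPTI.
have JE : setT `&` J' @^-1` C = setT `*` (J @^-1` C).
  by apply/seteqP; split => [w []|w []]//=.
apply: indep_dynkin => //.
- move=> A A' [cA|NA] [cA'|NA'].
  + by left; exact: cylinders_setI.
  + by right; apply: negligibleS NA'; exact: subIsetr.
  + by right; apply: negligibleS NA; exact: subIsetl.
  + by right; apply: negligibleS NA; exact: subIsetl.
- by move=> A [|]; [exact: cylinders_measurable|exact: completion_negligible_measurable].
- move=> A [[A0 HA [A1 A1E <-]]|NA].
    have [/(_ T T0T)[_ mH] _] := H_filtration; have mA0 := mH _ HA.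
    have mA1 : measurable A1 by case: A1E => ->.
    rewrite JE -setXI setIT.
    rewrite !completed_productE//; last exact: measurableI.
    rewrite probability_setT mul1e; case: A1E => ->.
      by rewrite setTI probability_setT mule1.
    by rewrite set0I !measure0 !mule0 mul0e.
  have mA := completion_negligible_measurable NA.
  have A0 : P A = 0%E by exact/(negligibleP _ mA).
  rewrite A0 mul0e; apply/(negligibleP _ (measurableI _ _ mA mB)).
  by apply: negligibleS NA; exact: subIsetl.
Qed.

Hypothesis H_0 : H 0 = [set [set: Om0]; set0].

(** The sets that are null or have null complement form a sigma-algebra, which contains the
    generators because [H 0] is trivial. *)
Lemma uninformed0_trivial A : <<s F2 0 >> A -> P.-negligible A \/ P.-negligible (~` A).
Proof.
pose C := [set A : set Om | P.-negligible A \/ P.-negligible (~` A)].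
rewrite sigma_algebra_id; last exact: smallest_sigma_algebra.
suff : <<s cyl 0 `|` [set N | P.-negligible N] >> `<=` C by exact.
have neg0 : P.-negligible (set0 : set Om) by exact: negligible_set0.
apply: smallest_sub; first split.
- by left.
- by move=> B [NB|NB]; rewrite /C/= setTD setCK; [right|left].
- move=> F FC; have [[k NF]|NF] := pselect (exists k, P.-negligible (~` F k)).
    right; apply: negligibleS NF; apply: subsetC; exact: bigcup_sup.
  left; apply: negligible_bigcup => k; have [//|NFk] := FC k.
  by exfalso; apply: NF; exists k.
- move=> B [[B0 HB [B1 B1E <-]]|NB]; last by left.
  have [->|->] : B0 `*` B1 = set0 \/ B0 `*` B1 = setT.
  + move: HB; rewrite H_0 => -[->|->]; last by left; rewrite set0X.
    by case: B1E => ->; [right; rewrite setXTT|left; rewrite setX0].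
  + by left.
  + by right; rewrite setCT.
Qed.

Lemma uninformed0_constant (X : Om -> R) : measurable_wrt (F2 0) X ->
  P.-integrable setT (EFin \o X) -> {ae P, forall w, X w = \int[P]_w' X w'}.
Proof.
move=> mX iX; set v := \int[P]_w' X w'.
(* The event [0 < Y] is null or almost sure; in the second case [Y] agrees almost everywhere with
   its absolute value and has integral 0, so it vanishes almost everywhere. This is applied to
   [X - v] and to [v - X]. *)
have sign (Y : Om -> R) : measurable_wrt (F2 0) Y -> P.-integrable setT (EFin \o Y) ->
    \int[P]_w Y w = 0 -> {ae P, forall w, Y w <= 0}.
  move=> mY iY Y0.
  have FY : <<s F2 0 >> [set w | 0 < Y w].
    rewrite -[X in <<s _ >> X]setTI.
    exact: (@measurable_fun_ltr _ (g_sigma_algebraType (F2 0)) _ setT (cst 0) Y).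
  have [NY|NY] := uninformed0_trivial FY.
    apply: negligibleS NY => w /= /negP; by rewrite -ltNge.
  have Y_gt0 : {ae P, forall w, 0 < Y w} by [].
  have Yn : ae_eq P setT (EFin \o Y) (cst 0%E).
    apply/(ae_eq_integral_abs P measurableT); first exact: measurable_int iY.
    have -> : (\int[P]_w `|(EFin \o Y) w| = \int[P]_w (Y w)%:E)%E.
      apply: ae_eq_integral => //.
      - by apply: measurableT_comp => //; exact: measurable_int iY.
      - exact: measurable_int iY.
      - by apply: filterS Y_gt0 => w /ltW Yw _; rewrite /= ger0_norm.
    by rewrite -[LHS]fineK ?integrable_fin_num// -/(Rintegral _ _ _) Y0.
  by apply: filterS Yn => w /(_ I) /= [->].
have O0T : 0 <= (0 : R) <= T by rewrite lexx ltW.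
have icst (c : R) : P.-integrable setT (EFin \o cst c).
  exact: finite_measure_integrable_cst.
have ev : \int[P]_w (v : R) = v.
  by rewrite Rintegral_cst// [X in fine X](_ : _ = 1%E) ?mulr1//; exact: probability_setT.
have le1 : {ae P, forall w, X w - v <= 0}.
  apply: sign; first exact: measurable_funB.
    by apply: integB => //; exact: icst.
  rewrite RintegralB//; last exact: icst.
  by apply/eqP; rewrite subr_eq0; apply/eqP; exact: esym ev.
have le2 : {ae P, forall w, v - X w <= 0}.
  apply: sign; first exact: measurable_funB.
    by apply: integB => //; exact: icst.
  rewrite RintegralB//; last exact: icst.
  by apply/eqP; rewrite subr_eq0; apply/eqP; exact: ev.
apply: filterS2 le1 le2 => w; rewrite !subr_le0 => a b.
by apply/eqP; rewrite eq_le a.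
Qed.

End product_filtrations.

(** * Saddle point *)

Section independent_devices.
Context d (Om : measurableType d) (R : realType) (P : probability Om R).
Context (F : set (set Om)) (sF : sigma_algebra setT F) (F_sub : F `<=` measurable).
Context (Z Z' : Om -> R) (mZ : measurable_fun setT Z) (mZ' : measurable_fun setT Z').
Hypothesis ZZ'F : mutually_independent3 P (g_sigma_algebra_preimage Z)
  (g_sigma_algebra_preimage Z') F.

Let sZ (Y : Om -> R) : sigma_algebra setT (g_sigma_algebra_preimage Y).
Proof. exact: sigma_algebra_preimage (@sigma_algebra_measurable _ _). Qed.

Let preimageT (Y : Om -> R) : g_sigma_algebra_preimage Y setT.
Proof. by exists setT => //; rewrite preimage_setT setTI. Qed.

Lemma device_indep A B : <<s F >> A -> <<s g_sigma_algebra_preimage Z >> B ->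
  P (A `&` B) = (P A * P B)%E.
Proof.
rewrite !sigma_algebra_id// => FA GB.
by have := ZZ'F GB (preimageT Z') FA; rewrite setIT probability_setT mule1 setIC muleC.
Qed.

Lemma opponent_device_indep (mu : set R -> \bar R) :
  (forall B, measurable B -> P (Z' @^-1` B) = mu B) ->
  forall A B, <<s F `|` g_sigma_algebra_preimage Z >> A -> measurable B ->
  P (A `&` Z' @^-1` B) = (P A * mu B)%E.
Proof.
move=> muE A B GA mB; rewrite -muE//.
have GB : g_sigma_algebra_preimage Z' (Z' @^-1` B) by exists B => //; rewrite setTI.
move: A GA; apply: indep_join => //.
- by move=> C GC; apply: (g_sigma_preimage_sub mZ); exact: sub_sigma_algebra.
- by apply: (g_sigma_preimage_sub mZ'); exact: sub_sigma_algebra.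
- by rewrite -(sigma_algebra_id sF); exact: g_sigma_setI_closed.
- by rewrite -(sigma_algebra_id (sZ Z)); exact: g_sigma_setI_closed.
- by rewrite -(sigma_algebra_id sF); exact: g_sigma_setT.
- move=> A C FA GC; rewrite -setIA setIC ZZ'F// device_indep.
  + by rewrite muleC muleA.
  + exact: sub_sigma_algebra.
  + exact: sub_sigma_algebra.
Qed.

End independent_devices.

(** * Reversal of signs *)

Section opposite.
Context d (Om : measurableType d) (R : realType).

(** Positive and negative parts are exchanged; if one of them has infinite integral, [fine] returns
    0 on both sides. *)
Lemma RintegralN (mu : {measure set Om -> \bar R}) (A : set Om) (X : Om -> R) :
  \int[mu]_(w in A) (- X w) = - \int[mu]_(w in A) X w.
Proof.
rewrite /Rintegral integralE [in RHS]integralE.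
have -> : (fun w => (- X w)%:E) = (\- (EFin \o X))%E by [].
rewrite funeposN funenegN.
have : (0 <= \int[mu]_(x in A) (EFin \o X)^\- x)%E.
  by apply: integral_ge0 => w _; exact: funeneg_ge0.
have : (0 <= \int[mu]_(x in A) (EFin \o X)^\+ x)%E.
  by apply: integral_ge0 => w _; exact: funepos_ge0.
case: (\int[mu]_(x in A) (EFin \o X)^\+ x)%E => [x| |]//;
  case: (\int[mu]_(x in A) (EFin \o X)^\- x)%E => [y| |]// _ _ /=; rewrite ?oppr0//.
by rewrite opprB.
Qed.

Lemma supermartingaleN (P : probability Om R) (T : R) (F : R -> set (set Om))
    (N : R -> Om -> R) :
  supermartingale P T F N -> submartingale P T F (fun t w => - N t w).
Proof.
have intN (X : Om -> R) : P.-integrable setT (EFin \o X) ->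
    P.-integrable setT (EFin \o (fun w => - X w)).
  move=> iX; apply: (@eq_integrable _ _ _ _ _ measurableT (-%E \o (EFin \o X))%E) => //.
  exact: integrableN.
have wrtN G (X : Om -> R) : measurable_wrt G X -> measurable_wrt G (fun w => - X w).
  by move=> mX; exact: measurable_funN.
move=> [adN iN subN]; split.
- by move=> t tT; apply: wrtN; exact: adN.
- by move=> t tT; apply: intN; exact: iN.
- move=> s t s0 st tT; have [Y [mY iY YE] YN] := subN s t s0 st tT.
  exists (fun w => - Y w); last by apply: filterS YN => w; rewrite lerN2.
  split; [exact: wrtN|exact: intN|].
  by move=> A FA; rewrite !RintegralN YE.
Qed.

End opposite.

(** Condition (iii) multiplied by [1 - l], with [l] and [a] the left limit and the value of the
    opponent's generating path. If [l = 1] then [a = 1] and both sides are 0. *)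
Lemma stopping_cost_ge (R : realFieldType) (l a f h U : R) : l <= a -> a <= 1 ->
  (l < 1 -> U <= f + (h - f) * ((a - l) / (1 - l))) ->
  (1 - l) * U <= f * (1 - a) + h * (a - l).
Proof.
move=> la a1 UB; have [l1|l1] := ltP l 1.
  have l0 : 0 < 1 - l by rewrite subr_gt0.
  apply: (@le_trans _ _ ((1 - l) * (f + (h - f) * ((a - l) / (1 - l))))).
    by rewrite ler_pM2l// UB.
  rewrite le_eqVlt; apply/orP; left; apply/eqP; field.
  by rewrite gt_eqF.
have -> : l = 1 by apply/eqP; rewrite eq_le l1 (le_trans la).
have -> : a = 1 by apply/eqP; rewrite eq_le a1 (le_trans l1).
by rewrite !subrr !(mulr0, mul0r) addr0.
Qed.

(** Condition (iv) multiplied by the survival weight [S], with [p] the posterior. If [S = 0], both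
    of its nonnegative summands vanish and both sides are 0. *)
Lemma stopping_gain_le (R : realFieldType) (q l1 l0 a1 a0 g1 g0 h1 h0 V : R) :
  0 <= q <= 1 -> l1 <= a1 -> l0 <= a0 -> a1 <= 1 -> a0 <= 1 ->
  let S := q * (1 - l1) + (1 - q) * (1 - l0) in
  let p := q * (1 - l1) / S in
  (0 < S -> p * g1 + (1 - p) * g0 +
    (q * ((h1 - g1) * (a1 - l1)) + (1 - q) * ((h0 - g0) * (a0 - l0))) / S <= V) ->
  q * (g1 * (1 - a1) + h1 * (a1 - l1)) + (1 - q) * (g0 * (1 - a0) + h0 * (a0 - l0))
    <= S * V.
Proof.
move=> /andP[q0 q1] la1 la0 a11 a01 S p VB.
have l11 := le_trans la1 a11; have l01 := le_trans la0 a01.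
have S1 : 0 <= q * (1 - l1) by rewrite mulr_ge0// subr_ge0.
have S0 : 0 <= (1 - q) * (1 - l0) by rewrite mulr_ge0// subr_ge0.
have [S_gt0|S_le0] := ltP 0 S.
  apply: le_trans (_ : S * (p * g1 + (1 - p) * g0 +
    (q * ((h1 - g1) * (a1 - l1)) + (1 - q) * ((h0 - g0) * (a0 - l0))) / S) <= _).
    rewrite le_eqVlt; apply/orP; left; apply/eqP; rewrite /p /S; field.
    by rewrite -/S gt_eqF.
  by rewrite ler_pM2l// VB.
have e1 : q * (1 - l1) = 0 by apply/eqP; rewrite eq_le S1 andbT (le_trans _ S_le0)// lerDl.
have e0 : (1 - q) * (1 - l0) = 0 by apply/eqP; rewrite eq_le S0 andbT (le_trans _ S_le0)// lerDr.
have -> : S = 0 by rewrite /S e1 e0 addr0.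
(* Since [q] may be 0 or 1, only the weighted quantities are known to vanish; the remaining terms
   are rewritten through these products. *)
have b1 : q * (1 - a1) = 0.
  by apply/eqP; rewrite eq_le mulr_ge0 ?subr_ge0// andbT -e1 ler_wpM2l// lerD2l lerN2.
have b0 : (1 - q) * (1 - a0) = 0.
  by apply/eqP; rewrite eq_le mulr_ge0 ?subr_ge0// andbT -e0 ler_wpM2l ?subr_ge0// lerD2l lerN2.
have -> : q * (g1 * (1 - a1) + h1 * (a1 - l1)) =
  g1 * (q * (1 - a1)) + h1 * (q * (1 - l1) - q * (1 - a1)) by ring.
have -> : (1 - q) * (g0 * (1 - a0) + h0 * (a0 - l0)) =
  g0 * ((1 - q) * (1 - a0)) + h0 * ((1 - q) * (1 - l0) - (1 - q) * (1 - a0)) by ring.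
by rewrite e1 e0 b1 b0 subrr !mulr0 addr0 mul0r.
Qed.

(** The sum of the path suprema over the finite family bounds each member, all terms being
    nonnegative. *)
Lemma payoff_processes_dominated d (Om : measurableType d) (R : realType)
    (P : probability Om R) (T : R) (F : R -> set (set Om)) (I : finType)
    (X : I -> R -> Om -> R) : 0 < T ->
  (forall t, 0 <= t <= T -> <<s F t >> `<=` measurable) ->
  (forall i, payoff_process P T F (X i)) ->
  exists2 D, P.-integrable setT D & forall i, dominated_process T D (X i).
Proof.
move=> T_gt0 F_sub pX.
pose sup_norm i w := ereal_sup [set `|X i t w|%:E | t in `[0, T]%classic].
have norm_le i t w : 0 <= t <= T -> (`|X i t w|%:E <= sup_norm i w)%E.
  by move=> tT; apply: ereal_sup_ubound; exists t => //=; rewrite in_itv.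
have sup_ge0 i w : (0 <= sup_norm i w)%E.
  by apply: le_trans (norm_le i 0 w _); rewrite ?lee_fin// lexx ltW.
exists (fun w => \sum_(i : I) sup_norm i w)%E.
  by apply: integrable_sum => // i _; have [_ _] := pX i.
move=> i; have [adX cX _] := pX i; split=> [t tT||t w tT].
- exact: (measurable_sub_sigma (F_sub t tT) (adX t tT)).
- exact: cX.
- by rewrite (bigD1 i)//= (le_trans (norm_le i t w tT))// leeDl// sume_ge0.
Qed.


Lemma dominated_processN d (Om : measurableType d) (R : realType) (T : R)
    (D : Om -> \bar R) (X : R -> Om -> R) :
  dominated_process T D X -> dominated_process T D (fun t w => - X t w).
Proof.
move=> [mX cX XD]; split => [t tT|w|t w tT].
- by apply: measurable_funN; exact: mX.
- have [rX lX] := cX w; split=> t tT; first by apply: cvgN; exact: rX.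
  by apply: is_cvgN; exact: lX.
- by rewrite normrN XD.
Qed.

Theorem corollary5p2 (R : realType) (T : R) (T_gt0 : 0 < T)
  (d0 d1 : measure_display)
  (Om0 : measurableType d0) (Om1 : measurableType d1)
  (P0 : probability Om0 R) (P1 : probability Om1 R)
  (Om := completed_product P0 P1)
  (P := completed_product_prob P0 P1 : probability Om R)
  (H : R -> set (set Om0)) (H_filtration : filtration T H)
  (H_usual : right_continuous_filtration T (complete_filtration P0 H))
  (H_0 : H 0 = [set [set: Om0]; set0])
  (F2 := uninformed_filtration P0 P1 H : R -> set (set Om))
  (F2_rc : right_continuous_filtration T F2)
  (J : {mfun Om1 >-> bool}) (pi0 : R) (J_law : P1 [set w | J w] = pi0%:E)
  (F1 := informed_filtration P0 P1 H J : R -> set (set Om))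
  (Z1 Z2 : {RV P >-> R}) (Z1_unif : uniform01 Z1) (Z2_unif : uniform01 Z2)
  (Z_indep : mutually_independent3 P (g_sigma_algebra_preimage Z1)
               (g_sigma_algebra_preimage Z2) (F1 T))
  (f g h : bool -> R -> Om -> R)
  (f_payoff : forall j, payoff_process P T F2 (f j))
  (g_payoff : forall j, payoff_process P T F2 (g j))
  (h_payoff : forall j, payoff_process P T F2 (h j))
  (fhg : forall j, {ae P, forall w, forall t, 0 <= t <= T ->
           g j t w <= h j t w <= f j t w})
  (U : bool -> R -> Om -> R) (V : R -> Om -> R)
  (U_prog : forall i, progressively_measurable T F2 (U i))
  (V_prog : progressively_measurable T F2 V)
  (xi : bool -> R -> Om -> R) (zeta : R -> Om -> R)
  (xi_gen : forall i, generating_processes T F2 (xi i))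
  (zeta_gen : generating_processes T F2 zeta)
  (M_sub : forall i, submartingale P T F2 (M_process T (g i) zeta (U i)))
  (N_super : supermartingale P T F2 (N_process T pi0 f xi V))
  (U_bound : forall i, {ae P, forall w, forall t, 0 <= t <= T ->
     left_lim (zeta ^~ w) t < 1 ->
     f i t w + (h i t w - f i t w) *
       (jump (zeta ^~ w) t / (1 - left_lim (zeta ^~ w) t)) >= U i t w})
  (V_bound : {ae P, forall w, forall t, 0 <= t <= T -> survival pi0 xi t w > 0 ->
     pairing (posterior pi0 xi t w) (fun i => g i t w) +
     pairing pi0 (fun i => (h i t w - g i t w) * jump (xi i ^~ w) t) /
       survival pi0 xi t w <= V t w})
  (V_U_0 : {ae P, forall w, V 0 w = pairing pi0 (fun i => U i 0 w)}) :
  let S1 := randomised_stopping_times T Z1 F1 in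
  let S2 := randomised_stopping_times T Z2 F2 in
  let E tau sigma :=
    'E_P[payoff (mixture J f) (mixture J h) (mixture J g) tau sigma]%E in
  exists2 v : R, {ae P, forall w, V 0 w = v} &
    [/\ game_value S1 S2 E v,
        generating_processes T F1 (mixture J xi),
        generating_processes T F2 zeta &
        saddle_point S1 S2 E
          (generated_time T Z1 (mixture J xi)) (generated_time T Z2 zeta)].
Proof.
move=> S1 S2 E.
have T0T : 0 <= T <= T by rewrite lexx ltW.
have O0T : 0 <= (0 : R) <= T by rewrite lexx ltW.
have F2_sub t : 0 <= t <= T -> <<s F2 t >> `<=` measurable.
  exact: (uninformed_sub (P0 := P0) (P1 := P1) H_filtration).
have F2_id t : 0 <= t <= T -> <<s F2 t >> `<=` F2 t.
  by move=> _; rewrite sigma_algebra_id//; exact: smallest_sigma_algebra.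
have F2_mono := uninformed_mono (P0 := P0) (P1 := P1) H_filtration.
have F1_sub t : 0 <= t <= T -> <<s F1 t >> `<=` measurable.
  exact: (informed_sub (P0 := P0) (P1 := P1) H_filtration).
have F1_mono := informed_mono (P0 := P0) (P1 := P1) H_filtration (J := J).
pose J' (w : Om) := J w.2.
have F1E t : 0 <= t <= T -> F1 t `<=` <<s F2 t `|` g_sigma_algebra_preimage J' >> by move=> _ A.
have F12 t : 0 <= t <= T -> F2 t `<=` <<s F1 t >>.
  by move=> _; exact: uninformed_informed.
have J_F1 t : 0 <= t <= T -> g_sigma_algebra_preimage J' `<=` <<s F1 t >>.
  by move=> _ A JA; apply: sub_sigma_algebra; exact: g_sigmaU_r.
have mJ : measurable_fun setT J' by exact: measurable_J.
have J_indep := J_indep_uninformed (P0 := P0) (P1 := P1) T_gt0 H_filtration (J := J).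
have sF1 : sigma_algebra setT (F1 T) by exact: smallest_sigma_algebra.
have F1T_sub : F1 T `<=` measurable.
  by apply: subset_trans (F1_sub T T0T); exact: sub_sigma_algebra.
have mZ1 : measurable_fun setT Z1 by exact: measurable_funPT.
have mZ2 : measurable_fun setT Z2 by exact: measurable_funPT.
have Z_indep' : mutually_independent3 P (g_sigma_algebra_preimage Z2)
    (g_sigma_algebra_preimage Z1) (F1 T).
  by move=> A B C GA GB FC; rewrite [A `&` B]setIC Z_indep// [(P B * P A)%E]muleC.
(* The six payoff processes are collected in one finite family so as to share a single bound [D]. *)
pose X (x : bool + bool + bool) :=
  match x with inl (inl i) => f i | inl (inr i) => h i | inr i => g i end.
have [|D D_int XD] := @payoff_processes_dominated _ Om R P T F2 _ X T_gt0 F2_sub.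
  by move=> [[]|].
have fD i : dominated_process T D (f i) by exact: (XD (inl (inl i))).
have hD i : dominated_process T D (h i) by exact: (XD (inl (inr i))).
have gD i : dominated_process T D (g i) by exact: (XD (inr i)).
(* At time 0 the interval [[0, 0[] is empty and the left limits are 0, so the survival weight is
   1. *)
have NE : N_process T pi0 f xi V 0 = V 0.
  apply/funext => w; rewrite /N_process /pairing !set_itv_ge ?bnd_simp ?ltxx//.
  by rewrite !Rintegral_set0 /survival /pairing /left_lim lexx; ring.
have ME i : M_process T (g i) zeta (U i) 0 = U i 0.
  apply/funext => w; rewrite /M_process set_itv_ge ?bnd_simp ?ltxx//.
  by rewrite Rintegral_set0 /left_lim lexx; ring.
pose v := \int[P]_w V 0 w.
have [adN iN _] := N_super.
have iV : P.-integrable setT (EFin \o V 0) by rewrite -NE; exact: iN.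
(* [V 0] inherits [F2 0]-measurability from the adapted process [N], and [F2 0] is trivial up to
   null sets. *)
have Vv : {ae P, forall w, V 0 w = v}.
  apply: (uninformed0_constant T_gt0 H_0) => //.
  by rewrite -NE; exact: adN.
have iU i : P.-integrable setT (EFin \o U i 0).
  by have [_ iM _] := M_sub i; rewrite -ME; exact: iM.
have prob_true : fine (P [set w | J' w = true]) = pi0.
  by rewrite (prob_J P0 P1 J true) J_law.
have prob_false : fine (P [set w | J' w = false]) = 1 - pi0.
  rewrite (prob_J P0 P1 J false).
  have mJ1 : measurable [set w | J w] by have := @measurable_funPTI _ _ _ _ J [set true]; apply.
  have -> : [set w | J w = false] = ~` [set w | J w].
    by apply/seteqP; split => w /=; [move=> ->|case: (J w)].
  by rewrite probability_setC// J_law.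
have pi01 : 0 <= pi0 <= 1.
  have mJ1 : measurable [set w | J w] by have := @measurable_funPTI _ _ _ _ J [set true]; apply.
  by rewrite -!lee_fin -J_law measure_ge0 probability_le1.
have vU : v = pi0 * (\int[P]_w U true 0 w) + (1 - pi0) * (\int[P]_w U false 0 w).
  have iZ c i : P.-integrable setT (EFin \o (fun w => c * U i 0 w)) by exact: integZ.
  transitivity (\int[P]_w (pi0 * U true 0 w + (1 - pi0) * U false 0 w)).
    have iS := integD (iZ pi0 true) (iZ (1 - pi0) false).
    exact: ae_eq_Rintegral (integ_measurable iV) (integ_measurable iS) V_U_0.
  by rewrite RintegralD// !RintegralZl.
have uninformed_generating rho : generating_processes T F2 rho -> generating_processes T F1 rho.
  move=> [adrho prho]; split => // t tT.
  by apply: measurable_wrt_sub (adrho t tT); exact: F12.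
have gen_mix : generating_processes T F1 (mixture J xi).
  split=> [t tT|w].
    have mJ1 : measurable_fun setT (J' : g_sigma_algebraType (F1 t) -> bool).
      by move=> _ B mB; apply: (J_F1 t tT); exists B.
    have xi1 i := (uninformed_generating _ (xi_gen i)).1 t tT.
    exact: (measurable_fun_ifT mJ1 (xi1 true) (xi1 false)).
  rewrite (_ : mixture J xi ^~ w = xi (J w.2) ^~ w); first exact: (xi_gen _).2.
  by apply/funext => t; rewrite /mixture; case: (J w.2).
have zeta_gen1 : generating_processes T F1 zeta.
  exact: uninformed_generating.
have lower rho : generating_processes T F1 rho ->
    v <= \int[P]_w payoff (mixture J f) (mixture J h) (mixture J g)
      (generated_time T Z1 rho) (generated_time T Z2 zeta) w.
  move=> grho.
  (* The uninformed strategy is the mixture of a constant family. *)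
  have zE : generated_time T Z2 (mix J' (fun=> zeta)) = generated_time T Z2 zeta.
    congr (generated_time _ _ _); apply/funext => t; apply/funext => w.
    by rewrite /mix; case: (J' w).
  rewrite vU -prob_false -prob_true -!ME -zE.
  have opp : forall A B, <<s F1 T `|` g_sigma_algebra_preimage Z1 >> A -> measurable B ->
      P (A `&` Z2 @^-1` B) = (P A * uniform_prob (@ltr01 R) B)%E.
    exact: (opponent_device_indep sF1 F1T_sub mZ1 mZ2 Z_indep Z2_unif).
  have dev := device_indep sF1 Z_indep.
  apply: (@informed_lower_bound _ Om R P T T_gt0 F1 F2 J' Z1 mZ1 F2_sub F2_id F2_mono
    F1_sub F1_mono F1E F12 mJ J_indep dev Z2 mZ2 opp J_F1 D D_int f h g fD hD gD _ _ _ _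
    (fun=> zeta) _ (fun i => M_process T (g i) zeta (U i)) rho) => //.
  - by move=> i; have [] := f_payoff i.
  - by move=> i; have [] := h_payoff i.
  - by move=> i; have [] := g_payoff i.
  - by move=> i; apply: filterS (fhg i) => w fw t tT; have /andP[] := fw t tT.
  - move=> i; apply: filterS (U_bound i) => w Uw t tT.
    have pz := zeta_gen.2 w; rewrite /M_process -addrA lerD2l.
    apply: stopping_cost_ge; first exact: left_lim_le pz tT.
      by have /andP[] := generating_path_le1 pz tT.
    exact: Uw.
have upper rho : generating_processes T F2 rho ->
    \int[P]_w payoff (mixture J f) (mixture J h) (mixture J g)
      (generated_time T Z1 (mixture J xi)) (generated_time T Z2 rho) w <= v.
  move=> grho.
  (* Player 2 becomes the minimiser for the payoffs [- g], [- h], [- f], the two times and the two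
     devices being exchanged. *)
  pose opp (Y : bool -> R -> Om -> R) i t w := - Y i t w.
  have oppD Y : (forall i, dominated_process T D (Y i)) ->
      forall i, dominated_process T D (opp Y i).
    by move=> DY i; exact: dominated_processN.
  have oppad Y : (forall i, adapted T F2 (Y i)) -> forall i, adapted T F2 (opp Y i).
    by move=> aY i t tT; apply: measurable_funN; exact: aY.
  have -> : \int[P]_w payoff (mixture J f) (mixture J h) (mixture J g)
      (generated_time T Z1 (mixture J xi)) (generated_time T Z2 rho) w =
    - \int[P]_w payoff (mix J' (opp g)) (mix J' (opp h)) (mix J' (opp f))
      (generated_time T Z2 rho) (generated_time T Z1 (mixture J xi)) w.
    have oppE Y t w : mix J' (opp Y) t w = - mixture J Y t w.
      by rewrite /mix /opp /mixture /J'; case: (J w.2).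
    rewrite -RintegralN; apply: eq_Rintegral => w _.
    rewrite /payoff !oppE.
    by case: (ltgtP (generated_time T Z1 _ w) (generated_time T Z2 rho w)) => [_|_|->] /=; ring.
  rewrite lerNl -RintegralN.
  have opi : forall A B, <<s F1 T `|` g_sigma_algebra_preimage Z2 >> A -> measurable B ->
      P (A `&` Z1 @^-1` B) = (P A * uniform_prob (@ltr01 R) B)%E.
    exact: (opponent_device_indep sF1 F1T_sub mZ2 mZ1 Z_indep' Z1_unif).
  have dev := device_indep sF1 Z_indep'.
  have -> : \int[P]_w (- V 0 w) = \int[P]_w (- N_process T pi0 f xi V 0 w) by rewrite NE.
  apply: (@uninformed_lower_bound _ Om R P T T_gt0 F1 F2 J' Z2 mZ2 F2_sub F2_id F2_mono
    F1_sub F1_mono F1E F12 mJ J_indep dev Z1 mZ1 opi J_F1 D D_int (opp g) (opp h) (opp f)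
    (oppD _ gD) (oppD _ hD) (oppD _ fD) _ _ _ _ xi xi_gen
    (fun t w => - N_process T pi0 f xi V t w) rho) => //.
  - by apply: oppad => i; have [] := g_payoff i.
  - by apply: oppad => i; have [] := h_payoff i.
  - by apply: oppad => i; have [] := f_payoff i.
  - move=> i; apply: filterS (fhg i) => w fw t tT; rewrite lerN2.
    by have /andP[] := fw t tT.
  - exact: supermartingaleN.
  - rewrite prob_true prob_false; apply: filterS V_bound => w Vw t tT.
    have p1 := (xi_gen true).2 w; have p0 := (xi_gen false).2 w.
    rewrite /N_process /opp !RintegralN /pairing.
    have /andP[_ a1] := generating_path_le1 p1 tT.
    have /andP[_ a0] := generating_path_le1 p0 tT.
    have := stopping_gain_le pi01 (left_lim_le p1 tT) (left_lim_le p0 tT) a1 a0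
      (Vw t tT).
    (* The goal is the cleared form of condition (iv) with signs reversed, plus the integrals over
       [[0, t[] common to both sides. *)
    rewrite /survival /pairing /jump; lra.
have mixture_dominated (Y : bool -> R -> Om -> R) : (forall i, dominated_process T D (Y i)) ->
    dominated_process T D (mixture J Y).
  by move=> DY; exact: (dominated_mix mJ DY).
have EE rho1 rho2 : generating_processes T F1 rho1 -> generating_processes T F2 rho2 ->
    E (generated_time T Z1 rho1) (generated_time T Z2 rho2) =
    (\int[P]_w payoff (mixture J f) (mixture J h) (mixture J g)
      (generated_time T Z1 rho1) (generated_time T Z2 rho2) w)%:E.
  move=> g1 g2; rewrite /E unlock /Rintegral fineK//.
  apply: integrable_fin_num => //.
  apply: (integrable_payoff T_gt0 D_int); [exact: mixture_dominated..| | | |].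
  - apply: (measurable_crossing T_gt0) => // [w|t tT]; first exact: g1.2.
    exact: (measurable_sub_sigma (F1_sub t tT) (g1.1 t tT)).
  - apply: (measurable_crossing T_gt0) => // [w|t tT]; first exact: g2.2.
    exact: (measurable_sub_sigma (F2_sub t tT) (g2.1 t tT)).
  - by move=> w; exact: crossing_itv.
  - by move=> w; exact: crossing_itv.
have Ev : E (generated_time T Z1 (mixture J xi)) (generated_time T Z2 zeta) = v%:E.
  by rewrite EE//; congr EFin; apply/eqP; rewrite eq_le upper// lower.
have S1x : S1 (generated_time T Z1 (mixture J xi)) by exists (mixture J xi).
have S2y : S2 (generated_time T Z2 zeta) by exists zeta.
have E_le y : S2 y -> (E (generated_time T Z1 (mixture J xi)) y <= v%:E)%E.
  by move=> [rho grho <-]; rewrite EE// lee_fin upper.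
have E_ge x : S1 x -> (v%:E <= E x (generated_time T Z2 zeta))%E.
  by move=> [rho grho <-]; rewrite EE// lee_fin lower.
exists v => //; split => //; last first.
  by split => // [y|x] S; rewrite Ev; [exact: E_le|exact: E_ge].
(* Each of the two values is squeezed at [v] by fixing the equilibrium strategy of one player and
   using [E_le] or [E_ge] against all responses. *)
split; apply/eqP; rewrite eq_le; apply/andP; split.
- apply: (@le_trans _ _ (ereal_sup [set E (generated_time T Z1 (mixture J xi)) y | y in S2])).
    by apply: ereal_inf_lbound; exists (generated_time T Z1 (mixture J xi)).
  by apply: ge_ereal_sup => _ [y Sy <-]; exact: E_le.
- apply: le_ereal_inf_tmp => _ [x Sx <-]; apply: (le_trans (E_ge x Sx)).
  by apply: ereal_sup_ubound; exists (generated_time T Z2 zeta).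
- apply: ge_ereal_sup => _ [y Sy <-]; apply: (le_trans _ (E_le y Sy)).
  by apply: ereal_inf_lbound; exists (generated_time T Z1 (mixture J xi)).
- apply: (@le_trans _ _ (ereal_inf [set E x (generated_time T Z2 zeta) | x in S1])).
    by apply: le_ereal_inf_tmp => _ [x Sx <-]; exact: E_ge.
  by apply: ereal_sup_ubound; exists (generated_time T Z2 zeta).
Qed.
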